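(* For $a_1,a_2\in\mathbb{Z}$ let $g_{a_1,a_2}(z)\in\mathbb{Z}((z^{-1}))$ be a Laurent series satisfying $$g_{a_1,a_2}(z)=(z^2+a_1z+a_2)\,g_{a_1,a_2}(z^3).$$ Then for any integer $b$ with $|b|\ge 2$: (a) for any $s\in\mathbb{Z}$, if $g_{s,s^2}(b)$ is irrational then $\mu(g_{s,s^2}(b))=3$; (b) for any $s\in\mathbb{Z}$, if $g_{s^3,-s^2(s^2+1)}(b)$ is irrational then $\mu(g_{s^3,-s^2(s^2+1)}(b))=3$; (c) if $g_{\pm 2,1}(b)$ is irrational then $\mu(g_{\pm2,1}(b))=\frac{12}{5}$.
   Context: The irrationality exponent $\mu(\xi)$ of a real number $\xi$ is the supremum of the real numbers $\mu$ such that $|\xi-p/q|<q^{-\mu}$ has infinitely many rational solutions $p/q$. *)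

(* Defs.v *)
From HB Require Import structures.
From mathcomp Require Import all_boot all_order all_algebra.
From mathcomp Require Import all_classical all_reals all_analysis.
Import Order.TTheory GRing.Theory Num.Theory.
Import numFieldNormedType.Exports.

Set Implicit Arguments.
Unset Strict Implicit.
Unset Printing Implicit Defensive.

Local Open Scope classical_set_scope.
Local Open Scope ring_scope.

(* A((z^{-1})): [lcoef g k] is the coefficient of z^k, so the coefficients
   vanish for large k.  By proof irrelevance, Leibniz equality of Laurent
   series is equality of all coefficients. *)
Record laurent (A : nzRingType) := Laurent {
  lcoef : int -> A;
  lcoef_bounded : exists N : int, forall k : int, N < k -> lcoef k = 0
}.

Section Operations.
Variable A : nzRingType.
Implicit Types (P : {poly A}) (g : laurent A).

Definition lmulp_coef P g (k : int) : A :=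
  \sum_(i < size P) P`_i * lcoef g (k - i%:Z).

Lemma lmulp_bounded P g :
  exists N : int, forall k : int, N < k -> lmulp_coef P g k = 0.
Proof.
have [N hN] := lcoef_bounded g.
exists (N + (size P)%:Z) => k hk; rewrite /lmulp_coef big1 // => i _.
rewrite hN ?mulr0 // ltrBrDr (le_lt_trans _ hk) // lerD2l lez_nat.
exact: ltnW (ltn_ord i).
Qed.

(* P(z) * g(z) *)
Definition lmulp P g : laurent A := Laurent (lmulp_bounded P g).

Definition lsubstX_coef (d : nat) g (k : int) : A :=
  if (d%:Z %| k)%Z then lcoef g (k %/ d%:Z)%Z else 0.

Lemma lsubstX_bounded d g :
  exists N : int, forall k : int, N < k -> lsubstX_coef d g k = 0.
Proof.
have [N hN] := lcoef_bounded g.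
exists (`|N| * d%:Z) => k hk; rewrite /lsubstX_coef.
case: ifP => // /dvdzP [m km]; move: hk; rewrite {k}km.
case: d => [|d]; first by rewrite !mulr0 ltxx.
rewrite ltr_pM2r // => hm; rewrite mulzK // hN //.
exact: le_lt_trans (ler_norm N) hm.
Qed.

(* g(z^d), meaningful for 0 < d *)
Definition lsubstX d g : laurent A := Laurent (lsubstX_bounded d g).

End Operations.

(* The value g(x).  The first series has finitely many nonzero terms.  If the
   second one diverges its [limn] is the default real 0, so that g(x) is then
   rational when x is an integer. *)
Definition leval (R : realType) (g : laurent int) (x : R) : R :=
  limn (series (fun n : nat => (lcoef g n%:Z)%:~R * x ^+ n : R^o)) +
  limn (series (fun n : nat => (lcoef g (- n.+1%:Z))%:~R * x ^- n.+1 : R^o)).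

(* Rational solutions p/q are counted as rational numbers, written in lowest
   terms with q = denq r > 0. *)
Definition irrationality_exponent (R : realType) (xi : R) : \bar R :=
  ereal_sup [set mu%:E | mu in [set mu : R |
    infinite_set [set r : rat | `|xi - ratr r| < (denq r)%:~R `^ (- mu)]]].

(* Main.v *)
Require Import Defs.
From mathcomp Require Import all_boot all_order all_algebra.
From mathcomp Require Import all_classical all_reals all_analysis.
From mathcomp Require Import ring lra zify.
Import Order.TTheory GRing.Theory Num.Theory.
Import numFieldNormedType.Exports.
Local Open Scope classical_set_scope.
Local Open Scope ring_scope.

Set Implicit Arguments.
Unset Strict Implicit.
Unset Printing Implicit Defensive.

(* Iterating the functional equation gives g(b) = P_m(b) g(b^(3^m)) with
   P_m(z) = prod_{t<m} P(z^(3^t)).  If p/q is a rational function with deg q = k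
   and q g - p of exact order z^(-e-1) at infinity, then P_m(b) p(B) / q(B),
   B = b^(3^m), has denominator of size |B|^k and q(B) g(b) - P_m(b) p(B) is of
   size |B|^(-e).  Since P and q(z^(3^j)), j > 0, are coprime, the common factors
   of P_m(b) and q(B) come, up to a bounded factor, from P_(m-J)(b), so that they
   are at most |B|^eta for every eta > 0.  Hence the exponent is at least
   1 + e/k, and it is at most this number as soon as the intervals of
   denominators controlled by the approximants leave no gap.
   Below (k, e) = (1, 2) in (a) and (2, 4) in (b); in (c) the large gap (5, 7)
   gives the value 1 + 7/5, and (1, 1), (4, 4) are needed to bridge the rest. *)

(** * Diophantine approximation *)

Lemma ratr_divz (R : realType) (p q : int) :
  ratr (p%:~R / q%:~R) = p%:~R / q%:~R :> R.
Proof. by rewrite fmorph_div /= !ratr_int. Qed.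

Lemma ratr_num_den (R : realType) (r : rat) :
  ratr r = (numq r)%:~R / (denq r)%:~R :> R.
Proof. by rewrite -{1}[r]divq_num_den ratr_divz. Qed.

Lemma denr_ge1 (R : realType) (r : rat) : 1 <= (denq r)%:~R :> R.
Proof. by rewrite -[1]/(1%:~R) ler_int -gtz0_ge1 denq_gt0. Qed.

Lemma numq_cross (p q : int) (r : rat) : q != 0 -> r = p%:~R / q%:~R ->
  numq r * q = p * denq r.
Proof.
move=> q0 rE; apply: (@intr_inj rat); rewrite !rmorphM /=.
have d0 : (denq r)%:~R != 0 :> rat by rewrite intr_eq0 denq_neq0.
rewrite -[in LHS](divfK d0 (numq r)%:~R).
by rewrite divq_num_den mulrAC {1}rE divfK ?intr_eq0.
Qed.

(** Turns an upper bound on the common factor of [p] and [q] into a lower bound on the reduced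
    denominator. *)
Lemma dvdz_gcd_denq (p q : int) (r : rat) : q != 0 -> r = p%:~R / q%:~R ->
  (q %| gcdz p q * denq r)%Z.
Proof.
move=> q0 rE; rewrite mulrC -{1}[denq r]gez0_abs ?denq_ge0// mulz_gcdr.
rewrite dvdz_gcd (dvdz_mull _ (dvdzz q)) andbT.
by apply/dvdzP; exists (numq r); rewrite (numq_cross q0 rE) mulrC.
Qed.

Lemma denq_div_le (R : realType) (p q : int) : q != 0 ->
  (denq (p%:~R / q%:~R))%:~R <= `|q%:~R : R|.
Proof.
move=> q0; rewrite -intr_norm ler_int; set r := _ / _.
have /dvdzP[z qE] : (denq r %| q)%Z.
  rewrite -(@Gauss_dvdzr _ (numq r)); last first.
    by rewrite coprimez_sym coprimezE; exact: coprime_num_den.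
  by apply/dvdzP; exists p; exact: numq_cross.
rewrite qE normrM (ger0_norm (denq_ge0 r)) ler_peMl ?denq_ge0//.
by rewrite -gtz0_ge1 normr_gt0; apply: contra_neq q0 => z0; rewrite qE z0 mul0r.
Qed.

(* Two distinct fractions differ by at least the inverse of the product of
   their denominators. *)
Lemma far_of_approx (R : realType) (xi mu : R) (p q : int) (r : rat) :
    let d := (denq r)%:~R : R in let r' := p%:~R / q%:~R : rat in
    q != 0 -> 2 * d * `|q%:~R * xi - p%:~R| <= 1 ->
    2 * `|q%:~R| <= d `^ (mu - 1) ->
    (denq r')%:~R `^ (- mu) <= `|xi - ratr r'| ->
  d `^ (- mu) <= `|xi - ratr r|.
Proof.
move=> d r' q0 h1 h2 h3.
have [rE|rNr] := eqVneq r r'; first by rewrite /d rE.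
have d1 : 1 <= d := denr_ge1 R r.
have d0 : 0 < d by exact: lt_le_trans d1.
set n := (numq r)%:~R : R.
have q0R : 0 < `|q%:~R : R| by rewrite normr_gt0 intr_eq0.
have : 1 <= `|q%:~R * n - p%:~R * d|.
  rewrite /n /d -!intrM -intrB -intr_norm -[1]/(1%:~R) ler_int -gtz0_ge1.
  rewrite normr_gt0. apply: contra_neq rNr => /eqP; rewrite subr_eq0 => /eqP e.
  rewrite /r' -[r]divq_num_den; apply/eqP.
  by rewrite eqr_div ?intr_eq0 ?denq_neq0// -!intrM mulrC e.
have -> : q%:~R * n - p%:~R * d = - (q%:~R * (d * xi - n)) + d * (q%:~R * xi - p%:~R).
  by ring.
move=> /le_trans /(_ (ler_normD _ _)); rewrite normrN !normrM (gtr0_norm d0) => h4.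
have -> : xi - ratr r = (d * xi - n) / d.
  by rewrite ratr_num_den -/n -/d; field; rewrite gt_eqF.
rewrite normrM [`|d^-1|]gtr0_norm ?invr_gt0// ler_pdivlMr//.
have -> : d `^ (- mu) * d = (d `^ (mu - 1))^-1.
  rewrite -powRN opprB addrC powRD ?powRr1 ?ltW//.
  by rewrite (gt_eqF d0) implybT.
apply: le_trans (_ : (2 * `|q%:~R|)^-1 <= _).
  by rewrite lef_pV2 // posrE ?powR_gt0// mulr_gt0.
rewrite -[_^-1]mul1r ler_pdivrMr ?mulr_gt0//; nra.
Qed.

Lemma finite_bounded_int (M : int) : finite_set [set z : int | `|z| <= M].
Proof.
apply: (@sub_finite_set _ _ ((Posz @` `I_(`|M|%N.+1)) `|`
                            ((fun n : nat => - n%:Z) @` `I_(`|M|%N.+1)))).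
  move=> z /= zM; have zM' : (`|z|%N < `|M|%N.+1)%N by lia.
  by case: (lerP 0 z) => z0; [left|right]; exists `|z|%N => //; lia.
by rewrite finite_setU; split; apply: finite_image; exact: finite_II.
Qed.

(** For [mu >= 0] a solution lies within 1 of [xi], so bounded denominators force bounded
    numerators. *)
Lemma finite_approx (R : realType) (xi mu D : R) : 0 <= mu ->
    (forall r : rat, D <= (denq r)%:~R -> (denq r)%:~R `^ (- mu) <= `|xi - ratr r|) ->
  finite_set [set r : rat | `|xi - ratr r| < (denq r)%:~R `^ (- mu)].
Proof.
move=> mu0 h.
pose M := Num.ceil ((`|xi| + 1) * `|D|).
apply: (@sub_finite_set _ _
  ((fun z : int * int => z.1%:~R / z.2%:~R : rat) @`
    ([set z | `|z| <= M] `*` [set z | `|z| <= Num.ceil `|D|]))); last first.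
  by apply: finite_image; apply: finite_setX; exact: finite_bounded_int.
move=> r /= hr; exists (numq r, denq r); last by rewrite /= divq_num_den.
have rD : (denq r)%:~R < D.
  by rewrite ltNge; apply/negP => /h; rewrite leNgt hr.
have d1 := denr_ge1 R r; have d0 : 0 < (denq r)%:~R :> R by lra.
have D0 : 0 < D by lra.
have r1 : `|ratr r : R| <= `|xi| + 1.
  have : (denq r)%:~R `^ (- mu) <= (denq r)%:~R `^ 0 by rewrite ler_powR//; lra.
  rewrite powRr0 => /(lt_le_trans hr)/ltW => h1.
  have -> : ratr r = xi - (xi - ratr r) :> R by rewrite subKr.
  by rewrite (le_trans (ler_normB _ _))// lerD2l.
have leM (x : int) (y : R) : `|x%:~R| <= y -> `|x| <= Num.ceil y.
  by move=> xy; rewrite -(ler_int R) intr_norm (le_trans xy)// Num.Theory.ceil_ge.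
have nE : (numq r)%:~R = ratr r * (denq r)%:~R :> R.
  by rewrite ratr_num_den divfK// gt_eqF.
split; apply: leM; last by rewrite (gtr0_norm d0) (gtr0_norm D0) ltW.
rewrite nE normrM (gtr0_norm d0) (gtr0_norm D0).
by rewrite ler_pM ?normr_ge0// ltW.
Qed.

Lemma irrationality_exponent_le (R : realType) (xi mu : R) :
    (forall nu, mu < nu ->
      finite_set [set r : rat | `|xi - ratr r| < (denq r)%:~R `^ (- nu)]) ->
  (irrationality_exponent xi <= mu%:E)%E.
Proof.
move=> h; apply: ub_ereal_sup => _ [nu /= hnu <-]; rewrite lee_fin leNgt.
by apply/negP => /h.
Qed.

Lemma irrationality_exponent_ge (R : realType) (xi mu : R) :
    (forall nu, nu < mu ->
      infinite_set [set r : rat | `|xi - ratr r| < (denq r)%:~R `^ (- nu)]) ->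
  (mu%:E <= irrationality_exponent xi)%E.
Proof.
move=> h; apply/lee_addgt0Pr => e e0.
rewrite -leeBlDr// -EFinB; apply: ereal_sup_ubound; exists (mu - e) => //=.
by apply: h; rewrite gtrBl.
Qed.

(** * Sequences of approximants and the exponent they determine *)

Lemma near_powR_ge (R : realType) (T : nat -> R) (theta K : R) :
  T @ \oo --> +oo -> 0 < theta -> \forall m \near \oo, K <= T m `^ theta.
Proof.
move=> Too th0; near=> m.
apply: (@le_trans _ _ (Num.max K 1)); first by rewrite le_max lexx.
have -> : Num.max K 1 = (Num.max K 1 `^ theta^-1) `^ theta.
  by rewrite -powRrM mulVf ?gt_eqF// powRr1// le_max ler01 orbT.
apply: ge0_ler_powR; rewrite ?nnegrE ?powR_ge0 ?(ltW th0)//.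
- by near: m; exact: (cvgry_ge Too).
- by near: m; exact: (cvgry_ge Too).
Unshelve. all: by end_near. Qed.

(* The last clause says that p m / q m is nearly in lowest terms. *)
Definition approximants (R : realType) (T : nat -> R) (xi : R) (k e : nat)
    (p q : nat -> int) : Prop :=
  exists C : R, [/\ 0 < C,
    \forall m \near \oo, q m != 0 /\ `|(q m)%:~R| <= C * T m ^+ k,
    \forall m \near \oo,
      C^-1 <= `|(q m)%:~R * xi - (p m)%:~R| * T m ^+ e <= C &
    forall eta : R, 0 < eta -> exists2 c : R, 0 < c &
      \forall m \near \oo,
        c * T m `^ (k%:R - eta) <= (denq ((p m)%:~R / (q m)%:~R))%:~R].

Lemma finite_gt0_inf (R : realType) (I : choiceType) (S : set I) (f : I -> R) :
  finite_set S -> (forall i, S i -> 0 < f i) ->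
  exists2 d, 0 < d & forall i, S i -> d <= f i.
Proof.
move=> /finite_seqP[s ->]; elim: s => [|i s IH] f0; first by exists 1.
have [j js|d d0 ds] := IH; first by apply: f0; rewrite /= inE js orbT.
exists (Num.min (f i) d) => [|j /=]; first by rewrite lt_min d0 f0//= mem_head.
by rewrite inE => /orP[/eqP->|/ds]; rewrite ge_min ?lexx// => ->; rewrite orbT.
Qed.

Lemma normr_sub_div (R : realType) (xi : R) (p q : int) : q != 0 ->
  `|xi - ratr (p%:~R / q%:~R)| = `|q%:~R * xi - p%:~R| / `|q%:~R|.
Proof.
move=> q0; have q0R : q%:~R != 0 :> R by rewrite intr_eq0.
rewrite -normf_div ratr_divz; congr `| _ |; by field.
Qed.

(** If there were only finitely many solutions, irrationality would keep them at distance at least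
    some [d > 0] from [xi], whereas the approximants are solutions that tend to [xi]. Reduction to
    lowest terms is harmless: it lowers the denominator and so weakens the inequality to be met. *)
Lemma approximants_ge (R : realType) (T : nat -> R) (xi mu : R) k e p q :
  T @ \oo --> +oo -> (0 < k)%N -> (0 < e)%N -> irrational xi ->
  mu < 1 + e%:R / k%:R -> approximants T xi k e p q ->
  infinite_set [set r : rat | `|xi - ratr r| < (denq r)%:~R `^ (- mu)].
Proof.
move=> Too k0 e0 irr mule [C [C0 hq hqp _]].
have k0R : 0 < k%:R :> R by rewrite ltr0n.
have e0R : 0 < e%:R :> R by rewrite ltr0n.
(* Solutions for a larger exponent are solutions for a smaller one; [1 <= mu] allows the bound on
   [q m] to be raised to the power [mu - 1]. *)
wlog mu1 : mu mule / 1 <= mu.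
  move=> h; have [mu1|mu1] := leP 1 mu; first exact: h.
  apply: sub_infinite_set (h 1 _ (lexx _)); last by rewrite ltrDl divr_gt0.
  move=> r /= /lt_le_trans; apply; rewrite ler_powR ?denr_ge1//.
  by rewrite lerN2 ltW.
move=> /(@finite_gt0_inf R _ _ (fun r => `|xi - ratr r|)) [r _|d d0 hd].
  rewrite normr_gt0 subr_eq0; apply/eqP => xir; apply: irr; rewrite xir.
  by exists r.
have th0 : 0 < e%:R - k%:R * (mu - 1).
  by move: mule; rewrite addrC -ltrBlDr ltr_pdivlMr// => h; lra.
(* Of the last two thresholds on [T m], the first makes [p m / q m] a solution for [mu], the second
   puts it closer to [xi] than [d]. *)
have [m [] [qm0 qmC] /andP[_ Am] Tm1 Tm2 Tm3] : exists m : nat,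
  [/\ q m != 0 /\ `|(q m)%:~R| <= C * T m ^+ k,
      C^-1 <= `|(q m)%:~R * xi - (p m)%:~R| * T m ^+ e <= C, 1 <= T m,
      C `^ mu + 1 <= T m `^ (e%:R - k%:R * (mu - 1)) &
      C / d + 1 <= T m `^ e%:R].
  apply: (@filter_ex _ \oo); near=> m; split; near: m => //.
  - exact: (cvgry_ge Too).
  - exact: near_powR_ge.
  - exact: near_powR_ge.
have T0 : 0 < T m by lra.
move: Am qmC; rewrite -!powR_mulrn ?(ltW T0)//.
rewrite -ler_pdivlMr ?powR_gt0//.
set A := `|_ - _| => Am qmC.
have qm1 : 1 <= `|(q m)%:~R : R|.
  by rewrite -intr_norm -[1]/(1%:~R) ler_int -gtz0_ge1 normr_gt0.
have q0 : 0 < `|(q m)%:~R : R| by lra.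
have A0 : 0 <= A by exact: normr_ge0.
pose r := (p m)%:~R / (q m)%:~R : rat.
suff : d <= `|xi - ratr r|.
  rewrite normr_sub_div// -/A leNgt => /negP; apply.
  rewrite ltr_pdivrMr//; apply: (@lt_le_trans _ _ d); last by rewrite ler_peMr// ltW.
  apply: (le_lt_trans Am); rewrite ltr_pdivrMr ?powR_gt0// mulrC -ltr_pdivrMr//.
  by apply: lt_le_trans Tm3; rewrite ltrDl.
apply: hd => /=; apply: (@lt_le_trans _ _ (`|(q m)%:~R| `^ (- mu))); last first.
  have d1 := denr_ge1 R r.
  rewrite !powRN lef_pV2 ?posrE ?powR_gt0 ?(lt_le_trans _ d1)//.
  by apply: ge0_ler_powR; rewrite ?nnegrE ?denq_div_le//; lra.
rewrite normr_sub_div// -/A ltr_pdivrMr// -[ltRHS]mulrC -{1}[`|_|]powRr1//.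
rewrite -powRD ?(gt_eqF q0) ?implybT// -[1 - mu]opprB powRN -[_^-1]mul1r.
rewrite ltr_pdivlMr ?powR_gt0//.
have : `|(q m)%:~R| `^ (mu - 1) <= (C * T m `^ k%:R) `^ (mu - 1).
  by apply: ge0_ler_powR; rewrite ?nnegrE ?mulr_ge0 ?powR_ge0//; lra.
rewrite powRM ?powR_ge0 ?(ltW C0)// -powRrM => qmu.
apply: (le_lt_trans (ler_pM A0 (powR_ge0 _ _) Am qmu)).
rewrite mulrACA -powRN mulr_powRB1 ?ltW//; last lra.
rewrite -powRD ?(gt_eqF T0) ?implybT//.
have -> : - e%:R + k%:R * (mu - 1) = - (e%:R - k%:R * (mu - 1)) by ring.
rewrite powRN ltr_pdivrMr ?powR_gt0// mul1r; apply: lt_le_trans Tm2.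
by rewrite ltrDl.
Unshelve. all: by end_near. Qed.

(** The error is at least of order [T m ^ -(k + e)] and the reduced denominator at least of order
    [T m ^ (k - eta)], with [(k - eta) mu > k + e] for small [eta]. *)
Lemma approximants_self (R : realType) (T : nat -> R) (xi mu : R) k e p q :
  T @ \oo --> +oo -> (0 < k)%N -> 1 + e%:R / k%:R < mu ->
  approximants T xi k e p q ->
  \forall m \near \oo, (denq ((p m)%:~R / (q m)%:~R))%:~R `^ (- mu) <=
    `|xi - ratr ((p m)%:~R / (q m)%:~R)|.
Proof.
move=> Too k0 mule [C [C0 hq hqp hd]].
have k0R : 0 < k%:R :> R by rewrite ltr0n.
have mu0 : 0 < mu by apply: le_lt_trans mule; rewrite addr_ge0// divr_ge0.
have th0 : 0 < k%:R * mu - e%:R - k%:R.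
  by move: mule; rewrite addrC -ltrBrDr ltr_pdivrMr// => h; lra.
(* This [eta] spends half of the slack, [(k - eta) mu = k + e + (k mu - e - k) / 2]; the other half
   absorbs the constants. *)
have eta0 : 0 < (k%:R * mu - e%:R - k%:R) / (2 * mu) by rewrite divr_gt0 ?mulr_gt0.
have [c c0 hc] := hd _ eta0; near=> m.
have Tm1 : 1 <= T m by near: m; exact: (cvgry_ge Too).
have T0 : 0 < T m by lra.
have [qm0 qmC] : q m != 0 /\ `|(q m)%:~R| <= C * T m ^+ k by near: m.
have : C^-1 <= `|(q m)%:~R * xi - (p m)%:~R| * T m ^+ e <= C by near: m.
move=> /andP[Am _]; rewrite normr_sub_div//.
have cm : c * T m `^ (k%:R - (k%:R * mu - e%:R - k%:R) / (2 * mu)) <=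
    (denq ((p m)%:~R / (q m)%:~R))%:~R by near: m.
have Tm2 : C ^+ 2 / c `^ mu <= T m `^ ((k%:R * mu - e%:R - k%:R) / 2).
  by near: m; apply: near_powR_ge => //; rewrite divr_gt0.
set r := (p m)%:~R / (q m)%:~R in cm *.
move: Am qmC; rewrite -!powR_mulrn ?(ltW T0)//.
rewrite -ler_pdivrMr ?powR_gt0//.
set A := `|_ - _| => Am qmC.
have q0 : 0 < `|(q m)%:~R : R| by rewrite normr_gt0 intr_eq0.
have -> : A / `|(q m)%:~R| = (`|(q m)%:~R| / A)^-1 by rewrite invf_div.
have A0 : 0 < A by apply: lt_le_trans Am; rewrite divr_gt0 ?invr_gt0 ?powR_gt0.
have d1 := denr_ge1 R r; have d0 : 0 < (denq r)%:~R :> R by lra.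
rewrite powRN lef_pV2 ?posrE ?powR_gt0 ?divr_gt0//.
apply: (@le_trans _ _
  ((c * T m `^ (k%:R - (k%:R * mu - e%:R - k%:R) / (2 * mu))) `^ mu)); last first.
  by apply: ge0_ler_powR; rewrite ?nnegrE ?mulr_ge0 ?powR_ge0//; lra.
rewrite powRM ?powR_ge0 ?(ltW c0)// -powRrM.
have -> : (k%:R - (k%:R * mu - e%:R - k%:R) / (2 * mu)) * mu =
  (k%:R * mu - e%:R - k%:R) / 2 + (k%:R + e%:R) by field; rewrite gt_eqF.
rewrite powRD ?(gt_eqF T0) ?implybT// mulrA.
apply: (@le_trans _ _ (C ^+ 2 * T m `^ (k%:R + e%:R))); last first.
  by rewrite ler_pM2r ?powR_gt0// mulrC -ler_pdivrMr ?powR_gt0.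
rewrite ler_pdivrMr//; apply: (le_trans qmC).
rewrite powRD ?(gt_eqF T0) ?implybT//.
have : 1 <= C * T m `^ e%:R * A.
  move: Am; rewrite ler_pdivrMr ?powR_gt0// -[C^-1]mul1r ler_pdivrMr// => /le_trans; apply.
  by rewrite mulrC [A * _]mulrC mulrA.
have -> : C ^+ 2 * (T m `^ k%:R * T m `^ e%:R) * A =
  C * T m `^ k%:R * (C * T m `^ e%:R * A) by ring.
by move=> ?; rewrite ler_peMr// mulr_ge0 ?powR_ge0 ?(ltW C0).
Unshelve. all: by end_near. Qed.

(** [far_of_approx] at the [m]-th approximant: the upper end of the range makes [2 d |q xi - p|] at
    most 1, the lower end makes [2 |q|] at most [d ^ (mu - 1)]. As [c] is fixed before [c0], the
    ranges of several families can be chained end to end. *)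
Lemma approximants_range (R : realType) (T : nat -> R) (xi mu : R) k e p q :
  T @ \oo --> +oo -> (0 < k)%N -> 1 + e%:R / k%:R < mu ->
  approximants T xi k e p q -> exists2 c : R, 0 < c &
  forall c0 e0 : R, 0 < c0 -> k%:R < e0 * (mu - 1) -> \forall m \near \oo, forall r : rat,
    c0 * T m `^ e0 <= (denq r)%:~R <= c * T m `^ e%:R ->
    (denq r)%:~R `^ (- mu) <= `|xi - ratr r|.
Proof.
move=> Too k0 mule hpq; have hself := approximants_self Too k0 mule hpq.
have mu1 : 0 <= mu - 1.
  by rewrite subr_ge0 (le_trans _ (ltW mule))// lerDl divr_ge0.
case: hpq => C [C0 hq hqp _].
exists (2 * C)^-1; first by rewrite invr_gt0 mulr_gt0.
move=> c0 e0 c00 kmu.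
near=> m => r /andP[rl ru].
have Tm1 : 1 <= T m by near: m; exact: (cvgry_ge Too).
have T0 : 0 < T m by lra.
have [qm0 qmC] : q m != 0 /\ `|(q m)%:~R| <= C * T m ^+ k by near: m.
have : C^-1 <= `|(q m)%:~R * xi - (p m)%:~R| * T m ^+ e <= C by near: m.
move=> /andP[_ Am].
have Tm2 : 2 * C / c0 `^ (mu - 1) <= T m `^ (e0 * (mu - 1) - k%:R).
  by near: m; apply: near_powR_ge => //; rewrite subr_gt0.
apply: (@far_of_approx _ _ _ (p m) (q m)) => //.
- move: Am; rewrite -powR_mulrn ?(ltW T0)// -ler_pdivlMr ?powR_gt0//.
  set A := `|_ - _| => Am.
  apply: (@le_trans _ _ (2 * ((2 * C)^-1 * T m `^ e%:R) * (C / T m `^ e%:R))).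
    by rewrite ler_pM ?mulr_ge0 ?normr_ge0// ?ler_pM2l// ler0z denq_ge0.
  have T00 : T m `^ e%:R != 0 by rewrite gt_eqF ?powR_gt0.
  by have -> : 2 * ((2 * C)^-1 * T m `^ e%:R) * (C / T m `^ e%:R) = 1
    by field; rewrite T00 gt_eqF.
- apply: (@le_trans _ _ ((c0 * T m `^ e0) `^ (mu - 1))); last first.
    by apply: ge0_ler_powR; rewrite ?nnegrE ?mulr_ge0 ?powR_ge0 ?(ltW c00)// ler0z denq_ge0.
  rewrite powRM ?powR_ge0 ?(ltW c00)// -powRrM.
  have -> : e0 * (mu - 1) = (e0 * (mu - 1) - k%:R) + k%:R by rewrite subrK.
  rewrite [T m `^ _]powRD ?(gt_eqF T0) ?implybT// mulrA powR_mulrn ?(ltW T0)//.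
  apply: (@le_trans _ _ (2 * C * T m ^+ k)); first by rewrite -mulrA ler_pM2l.
  by rewrite ler_pM2r ?exprn_gt0// [leRHS]mulrC -ler_pdivrMr ?powR_gt0.
- exact: (near hself m).
Unshelve. all: by end_near. Qed.

Lemma nearS (P : nat -> Prop) :
  (\forall m \near \oo, P m) -> \forall m \near \oo, P m.+1.
Proof. by move=> [N _ h]; exists N => // m /= Nm; apply: h => /=; exact: leqW. Qed.

(** [T m.+1] is the cube of [T m], so passing to the next index triples both exponents measured
    against [T m]. *)
Lemma approximants_shift (R : realType) (T : nat -> R) (xi : R) k e p q :
  T @ \oo --> +oo -> (forall m, T m.+1 = T m ^+ 3) ->
  approximants T xi k e p q ->
  approximants T xi (3 * k) (3 * e) (fun m => p m.+1) (fun m => q m.+1).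
Proof.
move=> Too TS [C [C0 hq hqp hd]]; exists C; split => //.
- by apply: filterS (nearS hq) => m; rewrite TS -exprM.
- by apply: filterS (nearS hqp) => m; rewrite TS -exprM.
- move=> eta eta0; have [|c c0 hc] := hd (eta / 3); first by rewrite divr_gt0.
  exists c => //; near=> m.
  have T0 : 0 <= T m by near: m; exact: (cvgry_ge Too).
  have -> : T m `^ ((3 * k)%:R - eta) = T m.+1 `^ (k%:R - eta / 3).
    rewrite TS -powR_mulrn// -powRrM natrM; congr (_ `^ _); by field.
  by near: m; exact: nearS hc.
Unshelve. all: by end_near. Qed.

(** The lower bound comes from the approximants. For the upper bound, the intervals between
    consecutive [c T m ^ e] tile all large denominators, so excluding solutions on each of them for
    large [m] leaves finitely many. *)
Lemma irrationality_exponent_approximants (R : realType) (T : nat -> R) (xi : R) k e p q :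
    (forall m, 1 <= T m) -> T @ \oo --> +oo -> (forall m, T m.+1 = T m ^+ 3) ->
    (0 < k)%N -> (0 < e)%N -> irrational xi -> approximants T xi k e p q ->
    (forall mu : R, 1 + e%:R / k%:R < mu -> exists2 c : R, 0 < c &
      \forall m \near \oo, forall r : rat,
        c * T m `^ e%:R <= (denq r)%:~R <= c * T m.+1 `^ e%:R ->
        (denq r)%:~R `^ (- mu) <= `|xi - ratr r|) ->
  irrationality_exponent xi = (1 + e%:R / k%:R)%:E.
Proof.
move=> T1 Too TS k0 e0 irr hpq hub.
have T0 m : 0 <= T m by exact: le_trans (T1 m).
apply/eqP; rewrite eq_le; apply/andP; split; last first.
  apply: irrationality_exponent_ge => nu hnu.
  exact: approximants_ge Too k0 e0 irr hnu hpq.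
apply: irrationality_exponent_le => nu hnu.
have [c c0 [N _ hc]] := hub _ hnu.
apply: (@finite_approx _ _ _ (c * T N `^ e%:R)) => [|r hr].
  by rewrite (le_trans _ (ltW hnu))// addr_ge0// divr_ge0.
have ex : exists n, (denq r)%:~R <= c * T (N + n)%N `^ e%:R.
  have : \forall m \near \oo, (denq r)%:~R / c <= T m `^ e%:R.
    by apply: near_powR_ge; rewrite // ltr0n.
  move=> [M _ hM]; exists M; rewrite mulrC -ler_pdivrMr//; apply: hM => /=.
  exact: leq_addl.
case: (ex_minnP ex) => -[|n] hn nmin.
  rewrite addn0 in hn; apply: (hc N) => //=; rewrite hr /= (le_trans hn)//.
  rewrite ler_pM2l// ge0_ler_powR ?nnegrE ?T0//.
by rewrite (TS N) ler_eXnr.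
apply: (hc (N + n)%N) => /=; first exact: leq_addr.
rewrite -addnS hn andbT leNgt; apply/negP => /ltW/nmin; by rewrite ltnn.
Qed.

(** The shifted family [(3k, 3e)] alone covers a whole tile, from [T m ^ e] to [T m ^ (3e)] up to
    constants: it needs [3k < e (mu - 1)], which [3 k^2 < e^2] ensures because [mu - 1 > e / k]. *)
Lemma irrationality_exponent_single (R : realType) (T : nat -> R) (xi : R) k e p q :
    (forall m, 1 <= T m) -> T @ \oo --> +oo -> (forall m, T m.+1 = T m ^+ 3) ->
    (0 < k)%N -> (3 * k ^ 2 < e ^ 2)%N -> irrational xi ->
    approximants T xi k e p q ->
  irrationality_exponent xi = (1 + e%:R / k%:R)%:E.
Proof.
move=> T1 Too TS k0 ke irr hpq; have e0 : (0 < e)%N by case: e ke {hpq}.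
apply: (irrationality_exponent_approximants T1 Too TS k0 e0 irr hpq) => mu hmu.
have k0R : 0 < k%:R :> R by rewrite ltr0n.
have k30 : (0 < 3 * k)%N by rewrite muln_gt0.
have hmu' : 1 + (3 * e)%:R / (3 * k)%:R < mu.
  by rewrite !natrM -mulf_div divff ?mul1r.
have [c c0 hc] := approximants_range Too k30 hmu' (approximants_shift Too TS hpq).
have kmu : (3 * k)%:R < e%:R * (mu - 1).
  have : (3 * k ^ 2)%:R < (e ^ 2)%:R :> R by rewrite ltr_nat.
  rewrite !natrM => ke2; rewrite -(ltr_pM2r k0R).
  have : e%:R / k%:R < mu - 1 by lra.
  rewrite ltr_pdivrMr// => emu; have : e%:R * e%:R <= e%:R * ((mu - 1) * k%:R).
    by rewrite ler_wpM2l// ltW.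
  by rewrite mulrA; apply: lt_le_trans; rewrite -mulrA.
have hn := hc c e%:R c0 kmu; exists c => //; near=> m => r.
have -> : T m.+1 `^ e%:R = T m `^ (3 * e)%:R.
  by rewrite TS -powR_mulrn ?(le_trans ler01)// -powRrM natrM.
by apply: (near hn m).
Unshelve. all: by end_near. Qed.

(** Measured against [T m], shifting yields the families [(9, 9)], [(12, 12)] and [(15, 21)], which
    cover the exponents 7 to 9, 9 to 12 and 12 to 21. The conditions [9 < 7 (mu - 1)],
    [12 < 9 (mu - 1)] and [15 < 12 (mu - 1)] hold since [mu - 1 > 7/5]. *)
Lemma irrationality_exponent_triple (R : realType) (T : nat -> R) (xi : R)
    p1 q1 p4 q4 p5 q5 :
    (forall m, 1 <= T m) -> T @ \oo --> +oo -> (forall m, T m.+1 = T m ^+ 3) ->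
    irrational xi -> approximants T xi 1 1 p1 q1 ->
    approximants T xi 4 4 p4 q4 -> approximants T xi 5 7 p5 q5 ->
  irrationality_exponent xi = (12 / 5)%:E.
Proof.
move=> T1 Too TS irr h1 h4 h5.
have -> : 12 / 5 = 1 + 7 / 5 :> R by field.
apply: (irrationality_exponent_approximants T1 Too TS _ _ irr h5) => // mu hmu.
have h9 := approximants_shift Too TS (approximants_shift Too TS h1).
have h12 := approximants_shift Too TS h4; have h15 := approximants_shift Too TS h5.
have [//||c9 c90 hc9] := approximants_range (mu := mu) Too _ _ h9; first by lra.
have [//||c12 c120 hc12] := approximants_range (mu := mu) Too _ _ h12; first by lra.
have [//||c15 c150 hc15] := approximants_range (mu := mu) Too _ _ h15; first by lra.
(* Each range starts with the constant at which the previous one stops; the first starts at [c15],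
   where the last range for the preceding index ended. *)
have h9' : \forall m \near \oo, _ := hc9 c15 7%:R c150 ltac:(lra).
have h12' : \forall m \near \oo, _ := hc12 c9 9%:R c90 ltac:(lra).
have h15' : \forall m \near \oo, _ := hc15 c12 12%:R c120 ltac:(lra).
exists c15 => //; near=> m => r.
have -> : T m.+1 `^ 7%:R = T m `^ (3 * (7))%:R.
  by rewrite TS -powR_mulrn ?(le_trans ler01)// -powRrM natrM.
move=> /andP[r7 r21].
have [r9|/ltW r9] := leP (denq r)%:~R (c9 * T m `^ 9%:R).
  by apply: (near h9' m) => //; rewrite r7.
have [r12|/ltW r12] := leP (denq r)%:~R (c12 * T m `^ 12%:R).
  by apply: (near h12' m) => //; rewrite r9.
by apply: (near h15' m) => //; rewrite r12.
Unshelve. all: by end_near. Qed.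

(** * Greatest common divisors and scaled approximants *)

(** Multiply two Bezout identities: every term of the product contains [x * y] or [z]. *)
Lemma dvdz_gcd_mul (x y z : int) : (gcdz (x * y) z %| gcdz x z * gcdz y z)%Z.
Proof.
have [u [v <-]] := Bezoutz x z; have [u' [v' <-]] := Bezoutz y z.
have -> : (u * x + v * z) * (u' * y + v' * z) =
  u * u' * (x * y) + (u * x * v' + v * u' * y + v * z * v') * z by ring.
by apply: rpredD; apply: dvdz_mull; rewrite ?dvdz_gcdl ?dvdz_gcdr.
Qed.

Lemma dvdz_gcd_mul_trans (x y z r s : int) :
  (gcdz x z %| r)%Z -> (gcdz y z %| s)%Z -> (gcdz (x * y) z %| r * s)%Z.
Proof. by move=> h1 h2; apply: (dvdz_trans (dvdz_gcd_mul _ _ _)); exact: dvdz_mul. Qed.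

Lemma dvdz_gcd_prod n (F r : 'I_n -> int) (z : int) :
  (forall i, gcdz (F i) z %| r i)%Z -> (gcdz (\prod_i F i) z %| \prod_i r i)%Z.
Proof.
move=> h; elim/big_ind2 : _ => //; last by move=> ? ? ? ?; exact: dvdz_gcd_mul_trans.
by rewrite gcd1z.
Qed.

Definition partial_prod (P : int -> int) (b : int) (m : nat) : int :=
  \prod_(t < m) P (b ^+ (3 ^ t)).

(** The first [m] factors are kept whole. Each of the last [J] is [P] at a point whose power with
    exponent [3 ^ (J - i)] is the argument of [q], so [r (J - i)] bounds its common factor with
    [q]. *)
Lemma dvdz_gcd_partial_prod (P q : int -> int) (r : nat -> int) (b : int) (J m : nat) :
  (forall j y, (0 < j)%N -> gcdz (P y) (q (y ^+ (3 ^ j))) %| r j)%Z ->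
  (gcdz (partial_prod P b (m + J)) (q (b ^+ (3 ^ (m + J)))) %|
    partial_prod P b m * \prod_(i < J) r (J - i)%N)%Z.
Proof.
move=> h; rewrite /partial_prod big_split_ord /=.
apply: dvdz_gcd_mul_trans; first exact: dvdz_gcdl.
apply: dvdz_gcd_prod => i.
have -> : b ^+ (3 ^ (m + J)) = b ^+ (3 ^ (m + i)) ^+ (3 ^ (J - i)).
  by rewrite -exprM -expnD -addnA subnKC// ltnW.
by apply: h; rewrite subn_gt0.
Qed.

Lemma near_subn (P : nat -> Prop) (J : nat) :
  (\forall m \near \oo, P (m + J)%N) -> \forall m \near \oo, P m.
Proof.
move=> [N _ h]; exists (N + J)%N => // m /= NJm.
have Jm : (J <= m)%N by exact: leq_trans (leq_addl N J) NJm.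
have -> : m = (m - J + J)%N by rewrite subnK.
by apply: h => /=; lia.
Qed.

Lemma cvg_neq0_bounds (R : realType) (u : nat -> R) (l : R) :
  u @ \oo --> l -> l != 0 ->
  exists2 C : R, 0 < C & \forall m \near \oo, C^-1 <= `|u m| <= C.
Proof.
move=> ul l0; have l0' : 0 < `|l| by rewrite normr_gt0.
have nul : `|u m| @[m --> \oo] --> `|l| by exact: cvg_norm.
exists (2 * `|l| + 2 / `|l|); first by rewrite addr_gt0 ?mulr_gt0 ?invr_gt0.
have lb : `|l| / 2 < `|l| by rewrite ltr_pdivrMr// ltr_pMr// ltr1n.
have ub : `|l| < `|l| * 2 by rewrite ltr_pMr// ltr1n.
near=> m.
have h1 : `|l| / 2 < `|u m| by near: m; exact: (cvgr_gt _ nul _ lb).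
have h2 : `|u m| < `|l| * 2 by near: m; exact: (cvgr_lt _ nul _ ub).
have h3 : 0 < 2 / `|l| by rewrite divr_gt0.
apply/andP; split; last lra.
apply: (le_trans _ (ltW h1)); rewrite -[leRHS]invf_div lef_pV2 ?posrE ?divr_gt0//; lra.
Unshelve. all: by end_near. Qed.

Definition scale (R : realType) (b : int) (m : nat) : R := `|b|%:~R ^+ (3 ^ m).

Lemma scaleS (R : realType) (b : int) m : scale R b m.+1 = scale R b m ^+ 3.
Proof. by rewrite /scale expnSr exprM. Qed.

Lemma scale_ge1 (R : realType) (b : int) m : 2 <= `|b| -> 1 <= scale R b m.
Proof. by move=> b2; rewrite /scale exprn_ege1// -[1]/(1%:~R) ler_int; lia. Qed.

Lemma scale_cvg (R : realType) (b : int) : 2 <= `|b| -> scale R b @ \oo --> +oo.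
Proof.
move=> b2; apply: (@ger_cvgy _ _ _ _ (fun n => n%:R)); last exact: cvgr_idn.
near=> m; apply: (@le_trans _ _ (3 ^ m)%:R).
  by rewrite ler_nat ltnW// ltn_expl.
apply: (@le_trans _ _ (2 ^+ (3 ^ m))).
  by rewrite -natrX ler_nat ltnW// ltn_expl.
have b2R : 2 <= `|b|%:~R :> R by rewrite -[2]/(2%:~R) ler_int.
by rewrite /scale lerXn2r ?nnegrE ?(le_trans _ b2R).
Unshelve. all: by end_near. Qed.

Section Scaled.
Variables (R : realType) (b : int) (P : int -> int) (f : nat -> R) (c : R).
Hypotheses (b2 : 2 <= `|b|) (f00 : f 0%N != 0) (c0 : c != 0).
Let y (m : nat) : int := b ^+ (3 ^ m).
Let T := @scale R b.
Hypothesis fS : forall m, f m = (P (y m))%:~R * f m.+1.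
Hypothesis fc : f m * (y m)%:~R @[m --> \oo] --> c.

Lemma normr_y m : `|(y m)%:~R| = T m.
Proof. by rewrite /T /scale /y rmorphXn normrX /= intr_norm. Qed.

Lemma scaled_prod m : f 0%N = (partial_prod P b m)%:~R * f m.
Proof.
elim: m => [|m IH]; first by rewrite /partial_prod big_ord0 mul1r.
by rewrite IH (fS m) /partial_prod big_ord_recr /= rmorphM mulrA.
Qed.

(** Here [f m] stands for the value of g at [y m]. As [f 0] is [partial_prod P b m] times [f m], and
    [f m] behaves like [c / y m], the product has the size of [y m]; multiplying the error by it
    costs one power, from [e.+1] to [e]. *)
Lemma approximants_scaled (k e : nat) (p q : int -> int) (r : nat -> int) (r0 : int) (L : R) :
  (q (y m))%:~R / (y m)%:~R ^+ k @[m --> \oo] --> (1 : R) ->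
  ((q (y m))%:~R * f m - (p (y m))%:~R) * (y m)%:~R ^+ e.+1 @[m --> \oo] --> L ->
  L != 0 -> r0 != 0 -> (forall j : nat, (0 < j)%N -> r j != 0) ->
  (forall z, gcdz (p z) (q z) %| r0)%Z ->
  (forall j z, (0 < j)%N -> gcdz (P z) (q (z ^+ (3 ^ j))) %| r j)%Z ->
  approximants T (f 0%N) k e (fun m => partial_prod P b m * p (y m)) (fun m => q (y m)).
Proof.
move=> hq hqp L0 r00 r0n hpq hPq.
have T0 m : 0 < T m := lt_le_trans ltr01 (scale_ge1 R m b2).
have TX0 m n : 0 < T m ^+ n by apply: exprn_gt0.
have y0 m : (y m)%:~R != 0 :> R by rewrite -normr_gt0 normr_y.
have prodE m : (partial_prod P b m)%:~R / (y m)%:~R = f 0%N / (f m * (y m)%:~R).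
  have f0 : f m != 0 by apply: contra_neq f00 => fm; rewrite (scaled_prod m) fm mulr0.
  by rewrite (scaled_prod m); field; rewrite f0 y0.
have prod_cvg : (partial_prod P b m)%:~R / (y m)%:~R @[m --> \oo] --> f 0%N / c.
  by under eq_fun do rewrite prodE; apply: cvgM; [exact: cvg_cst|exact: cvgV].
have prod0 m : partial_prod P b m != 0.
  by apply: contra_neq f00 => Pm; rewrite (scaled_prod m) Pm mul0r.
have [Cp Cp0 hCp] := cvg_neq0_bounds prod_cvg (mulf_neq0 f00 (invr_neq0 c0)).
have [Cq Cq0 hCq] := cvg_neq0_bounds hq (oner_neq0 _).
have err_cvg : (f 0%N / c * L) != 0 by rewrite !mulf_neq0// invr_neq0.
have [Ce Ce0 hCe] := cvg_neq0_bounds (cvgM prod_cvg hqp) err_cvg.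
have q_bounds : \forall m \near \oo, Cq^-1 * T m ^+ k <= `|(q (y m))%:~R| <= Cq * T m ^+ k.
  apply: filterS hCq => m; rewrite normrM normrV ?unitfE ?expf_neq0// normrX normr_y.
  move=> /andP[]; rewrite ler_pdivlMr ?TX0// => ->.
  by rewrite ler_pdivrMr ?TX0.
exists (Num.max Cq Ce); split; first by rewrite lt_max Cq0.
- apply: filterS q_bounds => m /andP[ql qu]; split.
    rewrite -(intr_eq0 R) -normr_gt0; apply: lt_le_trans ql.
    by rewrite mulr_gt0 ?invr_gt0 ?TX0.
  by rewrite (le_trans qu)// ler_wpM2r ?(ltW (TX0 _ _))// le_max lexx.
- apply: filterS hCe => m.
  have -> : `|(q (y m))%:~R * f 0%N - (partial_prod P b m * p (y m))%:~R| * T m ^+ e =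
    `|(partial_prod P b m)%:~R / (y m)%:~R *
      (((q (y m))%:~R * f m - (p (y m))%:~R) * (y m)%:~R ^+ e.+1)|.
    rewrite -normr_y -normrX -normrM (scaled_prod m) rmorphM; congr `|_|.
    by rewrite exprS; field; rewrite y0.
  move=> /andP[el eu]; rewrite (le_trans _ el) ?(le_trans eu) ?le_max ?lexx ?orbT//.
  by rewrite lef_pV2 ?posrE ?lt_max ?Cq0// le_max lexx orbT.
(* With [J] this large, [T m <= T (m + J) ^ eta], so the common factor at index [m + J], which
   divides [partial_prod P b m * K], is small enough. *)
- move=> eta eta0; have [J hJ] : exists J, 1 <= (3 ^ J)%:R * eta.
    have [N hN] : exists N : nat, eta^-1 <= N%:R.
      by exists (Num.truncn eta^-1).+1; rewrite ltW// truncnS_gt.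
    exists N; rewrite -ler_pdivrMr// mul1r (le_trans hN)// ler_nat ltnW// ltn_expl//.
  have [K Kn0 hK] : exists2 K : int, K != 0 & forall m,
      (gcdz (partial_prod P b (m + J) * p (y (m + J)%N)) (q (y (m + J)%N)) %|
       partial_prod P b m * K)%Z.
    exists (\prod_(i < J) r (J - i)%N * r0) => [|m].
      rewrite mulf_neq0//; apply/prodf_neq0 => i _.
      by rewrite r0n// subn_gt0.
    rewrite mulrA; apply: dvdz_gcd_mul_trans => //.
    exact: dvdz_gcd_partial_prod.
  have K0 : 0 < `|K%:~R : R| by rewrite normr_gt0 intr_eq0.
  exists (Cq * Cp * `|K%:~R|)^-1; first by rewrite invr_gt0 !mulr_gt0.
  apply: (@near_subn _ J).
  have q_boundsJ : \forall m \near \oo,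
      Cq^-1 * T (m + J)%N ^+ k <= `|(q (y (m + J)%N))%:~R|.
    case: q_bounds => [N _ hN]; exists N => // m /= Nm.
    by have /andP[] := hN (m + J)%N (leq_trans Nm (leq_addr _ _)).
  near=> m.
  have ql : Cq^-1 * T (m + J)%N ^+ k <= `|(q (y (m + J)%N))%:~R| by near: m.
  have : Cp^-1 <= `|(partial_prod P b m)%:~R / (y m)%:~R| <= Cp by near: m.
  rewrite normrM normrV ?unitfE// normr_y => /andP[_]; rewrite ler_pdivrMr// => Pm.
  have q0 : q (y (m + J)%N) != 0.
    rewrite -(intr_eq0 R) -normr_gt0; apply: lt_le_trans ql.
    by rewrite mulr_gt0 ?invr_gt0 ?TX0.
  set d := denq _.
  have : (q (y (m + J)%N) %| partial_prod P b m * K * d)%Z.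
    apply: dvdz_trans (dvdz_gcd_denq q0 erefl) _.
    by apply: dvdz_mul; [exact: hK|exact: dvdzz].
  have d0 : 0 < d by exact: denq_gt0.
  move=> /dvdzP[z zE].
  have : `|(q (y (m + J)%N))%:~R : R| <= `|(partial_prod P b m * K * d)%:~R|.
    rewrite zE rmorphM normrM ler_peMl ?normr_ge0// -intr_norm.
    rewrite -[1]/(1%:~R) ler_int -gtz0_ge1 normr_gt0.
    have : partial_prod P b m * K * d != 0 by rewrite !mulf_neq0// gt_eqF.
    by apply: contra_neq => z0; rewrite zE z0 mul0r.
  rewrite !rmorphM !normrM (gtr0_norm (_ : 0 < d%:~R)) ?ltr0z// => qd.
  have Teta : T m <= T (m + J)%N `^ eta.
    have -> : T (m + J)%N = T m `^ (3 ^ J)%:R.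
      by rewrite powR_mulrn ?(ltW (T0 _))// /T /scale -exprM expnD.
    rewrite -powRrM -{1}[T m]powRr1 ?(ltW (T0 _))// ler_powR// scale_ge1//.
  have dR0 : 0 < d%:~R :> R by rewrite ltr0z.
  rewrite powRB ?(gt_eqF (T0 _)) ?implybT// powR_mulrn ?(ltW (T0 _))//.
  have hTe : 0 < T (m + J)%N `^ eta by rewrite powR_gt0.
  rewrite mulrA ler_pdivrMr// [leLHS]mulrC ler_pdivrMr ?mulr_gt0//.
  move: ql; rewrite [Cq^-1 * _]mulrC ler_pdivrMr// => /le_trans; apply.
  have -> : d%:~R * T (m + J)%N `^ eta * (Cq * Cp * `|K%:~R|) =
    Cp * T (m + J)%N `^ eta * `|K%:~R| * d%:~R * Cq by ring.
  rewrite ler_pM2r//; apply: (le_trans qd).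
  rewrite !ler_pM2r//; apply: (le_trans Pm); rewrite ler_pM2l//.
Unshelve. all: by end_near. Qed.
End Scaled.

(** * The Mahler function at integer points *)

Section MahlerSeries.
Variables (g : laurent int) (u v : int).
Hypothesis gE : g = lmulp ('X^2 + u%:P * 'X + v%:P) (lsubstX 3 g).

Lemma lcoef_functional (k : int) :
  lcoef g k = lsubstX_coef 3 g (k - 2) + u * lsubstX_coef 3 g (k - 1)
              + v * lsubstX_coef 3 g k.
Proof.
rewrite {1}gE /= /lmulp_coef.
have -> : size ('X^2 + u%:P * 'X + v%:P) = 3%N.
  rewrite -addrA size_polyDl size_polyXn// (leq_ltn_trans (size_polyD _ _))//.
  rewrite gtn_max (leq_ltn_trans (size_polyMleq _ _))/= ?size_polyX ?size_polyC//.
  - exact: (leq_ltn_trans (leq_b1 _)).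
  - by case: (u != 0).
rewrite !big_ord_recl big_ord0 !coefE /= subr0.
rewrite -[(bump 0 0)%:Z]/(1 : int) -[(bump 0 (bump 0 0))%:Z]/(2 : int); ring.
Qed.

Lemma lsubstX_coef3 (m : int) : lsubstX_coef 3 g (3 * m) = lcoef g m.
Proof. by rewrite /lsubstX_coef dvdz_mulr// mulKz. Qed.

Lemma lsubstX_coef3_eq0 (k : int) : ~~ (3 %| k)%Z -> lsubstX_coef 3 g k = 0.
Proof. by rewrite /lsubstX_coef => /negPf ->. Qed.

(** The coefficients at [m] and [3 m + 2] agree, and for [m >= 0] this map moves strictly upward,
    beyond the bound above which all coefficients vanish. Hence g contains negative powers of z
    only. *)
Lemma lcoef_ge0 (k : int) : 0 <= k -> lcoef g k = 0.
Proof.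
have step (m : int) : lcoef g (3 * m + 2) = lcoef g m.
  rewrite lcoef_functional addrK lsubstX_coef3 !lsubstX_coef3_eq0; first by ring.
  - by lia.
  - by lia.
have [N hN] := lcoef_bounded g.
have up (n : nat) : forall m : int, N < m + n%:Z -> 0 <= m -> lcoef g m = 0.
  elim: n => [|n IH] m Nm m0; first by apply: hN; lia.
  by rewrite -step; apply: IH; lia.
by move=> k0; apply: (up `|N|.+1) => //; lia.
Qed.

(** Counting from z^-1 makes g(z) equal to z^-1 h(z^-1) with h(x) = (1 + u x + v x^2) h(x^3), so the
    coefficients follow the ternary digits of [n]. *)
Definition tail_coef (n : nat) : int := lcoef g (- n.+1%:Z).

Lemma tail_coef3 m : tail_coef (3 * m)%N = tail_coef m.
Proof.
rewrite /tail_coef lcoef_functional.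
have -> : - (3 * m)%N.+1%:Z - 2 = 3 * (- m.+1%:Z) by lia.
rewrite lsubstX_coef3 !lsubstX_coef3_eq0; first by ring.
- by lia.
- by lia.
Qed.

Lemma tail_coef31 m : tail_coef (3 * m + 1)%N = u * tail_coef m.
Proof.
rewrite /tail_coef lcoef_functional.
have -> : - (3 * m + 1)%N.+1%:Z - 1 = 3 * (- m.+1%:Z) by lia.
rewrite lsubstX_coef3 !lsubstX_coef3_eq0; first by ring.
- by lia.
- by lia.
Qed.

Lemma tail_coef32 m : tail_coef (3 * m + 2)%N = v * tail_coef m.
Proof.
rewrite /tail_coef lcoef_functional.
have -> : - (3 * m + 2)%N.+1%:Z = 3 * (- m.+1%:Z) by lia.
rewrite lsubstX_coef3 !lsubstX_coef3_eq0; first by ring.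
- by lia.
- by lia.
Qed.

Lemma tail_coef_divn3 n :
  `|tail_coef n| <= (1 + `|u| + `|v|) * `|tail_coef (n %/ 3)|.
Proof.
rewrite {1}(divn_eq n 3) mulnC; set m := (n %/ 3)%N.
have : (n %% 3 < 3)%N by rewrite ltn_mod.
case: (n %% 3)%N => [|[|[|//]]] _.
- by rewrite addn0 tail_coef3 ler_peMl; lia.
- by rewrite tail_coef31 normrM ler_wpM2r; lia.
- by rewrite tail_coef32 normrM ler_wpM2r; lia.
Qed.

Variable R : realType.

(** Each ternary digit contributes a bounded factor, so the growth is polynomial in [n]. The ratio
    3/2 leaves a geometric majorant of ratio 3/4 for [|x| <= 1/2]. *)
Lemma tail_coef_bound :
  exists2 C : R, 0 < C & forall n, `|(tail_coef n)%:~R| <= C * (3 / 2) ^+ n.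
Proof.
set M : R := (1 + `|u| + `|v|)%:~R; pose N := `|1 + `|u| + `|v| |%N.
have ME : M = N%:R by rewrite /M (_ : 1 + `|u| + `|v| = N%:Z)// /N; lia.
have M0 : 0 <= M by rewrite ME.
(* [C] dominates the coefficients below [(3 * N).+3]; beyond, [m = n %/ 3] is at least [N], and
   [M <= 2 ^ m <= (3/2) ^ (2 m)] pays for the factor [M]. *)
pose C : R := \sum_(n < (3 * N).+3) `|(tail_coef n)%:~R| + 1.
have C0 : 0 < C by rewrite ltr_wpDl// sumr_ge0.
exists C => // n; elim/ltn_ind: n => n IH.
have [n3|n3] := ltnP n (3 * N).+3.
  apply: (@le_trans _ _ C); last by rewrite ler_peMr ?(ltW C0)// exprn_ege1//; lra.
  rewrite /C (bigD1 (Ordinal n3))//= -addrA lerDl addr_ge0// sumr_ge0//.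
set m := (n %/ 3)%N; have mn : (m < n)%N by rewrite /m; lia.
have Nm : (N <= m)%N by rewrite /m; lia.
apply: (@le_trans _ _ (M * (C * (3 / 2) ^+ m))).
  apply: (@le_trans _ _ (M * `|(tail_coef m)%:~R|)); last first.
    by apply: ler_wpM2l => //; exact: IH.
  by rewrite /M -!intr_norm -intrM ler_int; exact: tail_coef_divn3.
rewrite mulrCA ler_pM2l//.
apply: (@le_trans _ _ ((3 / 2) ^+ (3 * m))); last first.
  by rewrite ler_weXn2l//; [lra|rewrite /m; lia].
have -> : (3 * m = 2 * m + m)%N by lia.
have h32 : 0 <= 3 / 2 :> R by lra.
rewrite exprD ler_wpM2r ?exprn_ge0//.
apply: (@le_trans _ _ (2 ^+ m)).
  by rewrite ME -natrX ler_nat (leq_trans Nm)// ltnW// ltn_expl.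
by rewrite exprM lerXn2r ?nnegrE//; lra.
Qed.

Definition tail_term (x : R) (n : nat) : R := (tail_coef n)%:~R * x ^+ n.

Lemma tail_term_bound :
  exists2 C : R, 0 < C & forall x n, `|x| <= 1 / 2 ->
    `|tail_term x n.+1| <= `|x| * (C * (3 / 4) ^+ n).
Proof.
have [C C0 hC] := tail_coef_bound; exists (C * (3 / 2)) => [|x n x2].
  by rewrite mulr_gt0.
rewrite /tail_term normrM normrX exprS mulrCA ler_wpM2l//.
have xn : `|x| ^+ n <= (1 / 2) ^+ n by rewrite lerXn2r// nnegrE; lra.
apply: le_trans (ler_pM _ _ (hC _) xn) _; rewrite ?exprn_ge0//.
by rewrite exprS -!mulrA -exprMn (_ : 3 / 2 * (1 / 2) = 3 / 4 :> R)//; lra.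
Qed.

Lemma tail_series_cvg (x : R) : `|x| <= 1 / 2 -> cvgn (series (tail_term x)).
Proof.
move=> x2; apply: normed_cvg; have [C C0 hC] := tail_coef_bound.
apply: (@series_le_cvg _ _ (geometric C (3 / 4))) => [n|n|n|] //=.
- by rewrite mulr_ge0 ?exprn_ge0 ?(ltW C0)//; lra.
- rewrite /tail_term normrM normrX.
  have xn : `|x| ^+ n <= (1 / 2) ^+ n by rewrite lerXn2r// nnegrE; lra.
  apply: le_trans (ler_pM _ _ (hC _) xn) _; rewrite ?exprn_ge0//.
  by rewrite -mulrA -exprMn (_ : 3 / 2 * (1 / 2) = 3 / 4 :> R)//; lra.
- by apply: is_cvg_geometric_series; rewrite ger0_norm; lra.
Qed.

(** The identity already holds exactly between the partial sums of lengths [3 * N] and [N]. *)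
Lemma tail_sum_functional (x : R) : `|x| <= 1 / 2 ->
  limn (series (tail_term x)) =
    (1 + u%:~R * x + v%:~R * x ^+ 2) * limn (series (tail_term (x ^+ 3))).
Proof.
move=> x2; have x32 : `|x ^+ 3| <= 1 / 2.
  rewrite normrX; apply: le_trans (_ : `|x| ^+ 1 <= _); last by [].
  by rewrite ler_wiXn2l//; lra.
have sum3 N : series (tail_term x) (3 * N)%N =
    (1 + u%:~R * x + v%:~R * x ^+ 2) * series (tail_term (x ^+ 3)) N.
  rewrite !seriesEnat /=; elim: N => [|N IH]; first by rewrite muln0 !big_geq// mulr0.
  rewrite mulnS addnC addn3 !big_nat_recr//= IH /tail_term.
  have -> : tail_coef (3 * N).+1 = u * tail_coef N by rewrite -tail_coef31 addn1.
  have -> : tail_coef (3 * N).+2 = v * tail_coef N by rewrite -tail_coef32 addn2.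
  by rewrite tail_coef3 -exprM !rmorphM /= !exprS; ring.
have lim1 : series (tail_term x) (3 * N)%N @[N --> \oo] --> limn (series (tail_term x)).
  apply: cvg_comp (tail_series_cvg x2) => A [N _ h].
  by exists N => // n /= Nn; apply: h => /=; lia.
apply: (cvg_unique _ lim1) => //.
have -> : (fun N => series (tail_term x) (3 * N)%N) = _ := funext sum3.
by apply: cvgM; [exact: cvg_cst|exact: tail_series_cvg].
Qed.

Lemma tail_sum_near0 : exists2 C : R, 0 < C & forall x, `|x| <= 1 / 2 ->
  `|limn (series (tail_term x)) - (tail_coef 0)%:~R| <= C * `|x|.
Proof.
have [C C0 hC] := tail_term_bound; exists (4 * C) => [|x x2]; first by rewrite mulr_gt0.
(* [4 * C * (1 - (3 / 4) ^+ n)] is the [n]-th partial sum of the geometric majorant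
   [C * (3 / 4) ^+ i]. *)
have part n : `|series (tail_term x) n.+1 - (tail_coef 0)%:~R| <=
    `|x| * (4 * C * (1 - (3 / 4) ^+ n)).
  elim: n => [|n IH].
    by rewrite seriesEnat /= big_nat1 /tail_term !expr0 mulr1 !subrr normr0 !mulr0.
  rewrite seriesSr addrAC (le_trans (ler_normD _ _))//.
  apply: le_trans (lerD IH (hC _ n x2)) _.
  by rewrite -mulrDr ler_wpM2l// exprS; lra.
have lim1 : `|series (tail_term x) n.+1 - (tail_coef 0)%:~R| @[n --> \oo] -->
    `|limn (series (tail_term x)) - (tail_coef 0)%:~R|.
  apply: cvg_norm; apply: cvgB; last exact: cvg_cst.
  have := tail_series_cvg x2; rewrite -(cvg_shiftS (series (tail_term x))); exact.
rewrite -(cvg_lim _ lim1)//; apply: limr_le; first by apply/cvg_ex; eexists; exact: lim1.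
near=> n; apply: (le_trans (part n)); rewrite mulrC ler_wpM2r//.
rewrite ler_piMr ?mulr_ge0 ?(ltW C0)// gerBl exprn_ge0//; lra.
Unshelve. all: by end_near. Qed.

Lemma leval_tail (x : R) : 2 <= `|x| ->
  leval g x = x^-1 * limn (series (tail_term x^-1)).
Proof.
move=> x2; rewrite /leval.
have -> : (fun n : nat => (lcoef g n%:Z)%:~R * x ^+ n : R^o) = fun=> 0.
  by apply/funext => n; rewrite lcoef_ge0// mul0r.
have -> : series (fun=> 0 : R^o) = fun=> 0.
  by apply/funext => n; rewrite seriesEnat /= big1.
rewrite lim_cst// add0r; apply: cvg_lim => //.
have -> : series (fun n : nat => (lcoef g (- n.+1%:Z))%:~R * x ^- n.+1 : R^o) =
    fun n => x^-1 * series (tail_term x^-1) n.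
  apply/funext => n; rewrite !seriesEnat /= mulr_sumr; apply: eq_bigr => i _.
  by rewrite /tail_term exprS invfM exprVn mulrCA.
apply: cvgM; [exact: cvg_cst|apply: tail_series_cvg].
by rewrite normfV div1r lef_pV2 ?posrE// (lt_le_trans _ x2).
Qed.

End MahlerSeries.

Lemma tail_coef_eq0 (g : laurent int) (u v : int) :
  g = lmulp ('X^2 + u%:P * 'X + v%:P) (lsubstX 3 g) -> tail_coef g 0 = 0 ->
  forall n, tail_coef g n = 0.
Proof.
move=> gE a0; elim/ltn_ind => -[//|n] IH.
have := tail_coef_divn3 gE n.+1.
by rewrite (IH _ (ltn_Pdiv _ _))// normr0 mulr0 normr_le0 => /eqP.
Qed.

(** The last limit encodes g(z) = c/z + c u/z^2 + c v/z^3 + ... along [y m], which is all that the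
    error computations use. It follows from h(x) = (1 + u x + v x^2) h(x^3) and h(x^3) = c +
    O(x^3). *)
Lemma leval_expansion (R : realType) (g : laurent int) (u v b : int) :
  g = lmulp ('X^2 + u%:P * 'X + v%:P) (lsubstX 3 g) -> 2 <= `|b| ->
  let y m : int := b ^+ (3 ^ m) in
  let f m : R := leval g (y m)%:~R in
  let c := tail_coef g 0 in
  [/\ forall m, f m = ((y m) ^+ 2 + u * y m + v)%:~R * f m.+1,
      (y m)%:~R^-1 @[m --> \oo] --> (0 : R) &
      ((f m * (y m)%:~R - c%:~R) * (y m)%:~R - c%:~R * u%:~R) * (y m)%:~R
        @[m --> \oo] --> (c%:~R * v%:~R : R)].
Proof.
move=> gE b2 y f c.
have y2 m : 2 <= `|(y m)%:~R : R|.
  have b2R : 2 <= `|b|%:~R :> R by rewrite -[2]/(2%:~R) ler_int.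
  rewrite /y rmorphXn normrX /= -intr_norm (le_trans b2R)// ler_eXnr ?expn_gt0//.
  by lra.
have y0 m : (y m)%:~R != 0 :> R by rewrite -normr_gt0; have := y2 m; lra.
have yi m : `|(y m)%:~R^-1 : R| <= 1 / 2.
  rewrite normfV div1r lef_pV2 ?posrE//; last exact: lt_le_trans (y2 m).
have yS m : (y m.+1)%:~R = (y m)%:~R ^+ 3 :> R.
  by rewrite /y expnSr exprM rmorphXn.
pose S (x : R) := limn (series (tail_term g x)).
have fE m : f m = (y m)%:~R^-1 * S (y m)%:~R^-1 by exact: (leval_tail gE (y2 m)).
have SE m : S (y m)%:~R^-1 =
    (1 + u%:~R / (y m)%:~R + v%:~R * (y m)%:~R^-1 ^+ 2) * S (y m.+1)%:~R^-1.
  by rewrite yS -exprVn; exact: (tail_sum_functional gE (yi m)).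
have ycvg : (y m)%:~R^-1 @[m --> \oo] --> (0 : R).
  apply/cvgr0Pnorm_lt => e e0; near=> m.
  have h : e^-1 < scale R b m.
    by near: m; apply: (cvgry_gt (@scale_cvg R b b2)).
  rewrite normfV -[e]invrK ltf_pV2 ?posrE ?invr_gt0//.
    by rewrite /y rmorphXn normrX /= -intr_norm.
  by have := y2 m; lra.
split => //.
- move=> m; rewrite !fE SE yS 2!rmorphD rmorphM (rmorphXn _ 2) /=.
  by field; rewrite y0.
- have [C C0 hC] := tail_sum_near0 gE R.
  (* Replacing the inner sum by [c] costs an error of order [(y m) ^ -3], so that [d m], scaled by
     [(y m) ^ 2], still tends to 0. *)
  pose d m : R := (S (y m.+1)%:~R^-1 - c%:~R) * (y m)%:~R ^+ 2.
  have d0 : d m @[m --> \oo] --> (0 : R).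
    apply/cvgr0Pnorm_lt => e e0; near=> m.
    have h : `|(y m)%:~R^-1| < e / C.
      by near: m; move: (e / C) (divr_gt0 e0 C0); apply/cvgr0Pnorm_lt.
    rewrite /d normrM; apply: (@le_lt_trans _ _ (C * `|(y m)%:~R^-1|)); last first.
      by rewrite mulrC -ltr_pdivlMr.
    apply: le_trans (ler_wpM2r _ (hC _ (yi m.+1))) _ => //.
    rewrite -mulrA -normrM yS; apply: ler_wpM2l; first exact: ltW.
    rewrite le_eqVlt; apply/orP; left; apply/eqP; congr `|_|.
    by field; rewrite y0.
  have -> : (fun m =>
      ((f m * (y m)%:~R - c%:~R) * (y m)%:~R - c%:~R * u%:~R) * (y m)%:~R) =
     (fun m => c%:~R * v%:~R + (1 + u%:~R * (y m)%:~R^-1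
       + v%:~R * ((y m)%:~R^-1 * (y m)%:~R^-1)) * d m).
    by apply/funext => m; rewrite fE SE /d; field; rewrite y0.
  rewrite -[X in _ --> X]addr0 -[in X in _ --> _ + X](mulr0 (1 + u%:~R * 0 + v%:~R * (0 * 0))).
  apply: cvgD; first exact: cvg_cst.
  apply: cvgM => //; apply: cvgD; first apply: cvgD; first exact: cvg_cst.
    by apply: cvgM => //; exact: cvg_cst.
  by apply: cvgM; [exact: cvg_cst|exact: cvgM].
Unshelve. all: by end_near. Qed.

(** * The Pade approximants of the three families *)

Lemma dvdz_subXX (x y : int) n : (x - y %| x ^+ n - y ^+ n)%Z.
Proof. by rewrite subrXX dvdz_mulr// dvdzz. Qed.

Lemma dvdz_gcd_lin (a a' x z r : int) : r = a * x + a' * z -> (gcdz x z %| r)%Z.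
Proof. by move=> ->; apply: rpredD; apply: dvdz_mull; rewrite ?dvdz_gcdl ?dvdz_gcdr. Qed.

(** Modulo [z - r], [q (z ^+ n)] is [q (r ^+ n)]. Since [q] is a bare function, [hq] supplies the
    congruence property of integer polynomials. *)
Lemma dvdz_gcd_root (q : int -> int) (r z : int) n :
  (forall x y, (x - y %| q x - q y)%Z) -> (gcdz (z - r) (q (z ^+ n)) %| q (r ^+ n)%R)%Z.
Proof.
move=> hq; have -> : q (r ^+ n) = q (z ^+ n) - (q (z ^+ n) - q (r ^+ n)) by ring.
apply: rpredB; first exact: dvdz_gcdr.
apply: dvdz_trans (dvdz_gcdl _ _) _; apply: dvdz_trans (dvdz_subXX z r n) _.
exact: hq.
Qed.

Lemma cvg_eq (R : realType) (w : nat -> R) (l l' : R) :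
  w @ \oo --> l -> l = l' -> w @ \oo --> l'.
Proof. by move=> wl <-. Qed.

(** Only sums, differences and products are handled, so powers of sequences are spelled out as
    products in the limits below. *)
Ltac cvg_poly :=
  repeat first [exact: cvg_cst | eassumption | apply: cvgB | apply: cvgD | apply: cvgM].

Section Cases.
Variables (R : realType) (b u v c : int) (y : nat -> int) (f : nat -> R).
Hypotheses (b2 : 2 <= `|b|) (f00 : f 0%N != 0) (c0 : c != 0).
Hypothesis yE : forall m, y m = b ^+ (3 ^ m).
Hypothesis fS : forall m, f m = (y m ^+ 2 + u * y m + v)%:~R * f m.+1.
Let x m : R := (y m)%:~R^-1.
Let lam m : R := ((f m * (y m)%:~R - c%:~R) * (y m)%:~R - c%:~R * u%:~R) * (y m)%:~R.
Hypothesis x_cvg : x @ \oo --> (0 : R).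
Hypothesis lam_cvg : lam @ \oo --> (c%:~R * v%:~R : R).

Lemma yR_neq0 m : (y m)%:~R != 0 :> R.
Proof. by rewrite intr_eq0 yE expf_neq0//; lia. Qed.

Lemma yRS m : (y m.+1)%:~R = (y m)%:~R ^+ 3 :> R.
Proof. by rewrite !yE expnSr exprM rmorphXn. Qed.

(** An exact identity with [lam m] as remainder: substituted into the error of an approximant, it
    gives a polynomial in [x] and [lam] whose limit is read off. *)
Lemma fE_lam m : f m = x m * (c%:~R + c%:~R * u%:~R * x m + lam m * x m ^+ 2).
Proof. by rewrite /lam /x; field; rewrite yR_neq0. Qed.

Lemma fS_real m :
  f m = ((y m)%:~R ^+ 2 + u%:~R * (y m)%:~R + v%:~R) * f m.+1.
Proof. by rewrite fS !(rmorphD, rmorphM, rmorphXn). Qed.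

Lemma shift_cvg (w : nat -> R) (l : R) :
  w @ \oo --> l -> (fun m => w m.+1) @ \oo --> l.
Proof. by move=> wl; rewrite -cvg_shiftS in wl. Qed.

Lemma f_y_cvg : f m * (y m)%:~R @[m --> \oo] --> (c%:~R : R).
Proof.
have -> : (fun m => f m * (y m)%:~R) =
    fun m => c%:~R + x m * (c%:~R * u%:~R + x m * lam m).
  by apply/funext => m; rewrite {1}fE_lam /x; field; rewrite yR_neq0.
by apply: cvg_eq; [cvg_poly|ring].
Qed.

Lemma f_cvg0 : f @ \oo --> (0 : R).
Proof.
have -> : f = fun m => (f m * (y m)%:~R) * x m.
  by apply/funext => m; rewrite /x mulfK// yR_neq0.
by apply: cvg_eq; [apply: cvgM; [exact: f_y_cvg|exact: x_cvg]|ring].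
Qed.

(** The numerator carries the leading coefficient [c] of g, so that [p] and [q] can be fixed integer
    polynomials; this multiplies the gcd bound [r0] by [c]. *)
Lemma approximants_of (k e : nat) (p q : int -> int) (r : nat -> int) (r0 : int) (L : R) :
  (q (y m))%:~R / (y m)%:~R ^+ k @[m --> \oo] --> (1 : R) ->
  ((q (y m))%:~R * f m - (c * p (y m))%:~R) * (y m)%:~R ^+ e.+1 @[m --> \oo] --> L ->
  L != 0 -> r0 != 0 -> (forall j : nat, (0 < j)%N -> r j != 0) ->
  (forall z, gcdz (p z) (q z) %| r0)%Z ->
  (forall j z, (0 < j)%N -> gcdz (z ^+ 2 + u * z + v) (q (z ^+ (3 ^ j))) %| r j)%Z ->
  exists p q, approximants (scale R b) (f 0%N) k e p q.
Proof.
move=> hq he L0 r00 rn hpq hPq; have yy : y = fun m => b ^+ (3 ^ m) by exact: funext.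
do 2 eexists; apply: (@approximants_scaled _ _ (fun z => z ^+ 2 + u * z + v) f c%:~R
  b2 f00 _ _ _ k e (fun z => c * p z) q r (c * r0) L) => //.
- by rewrite intr_eq0.
- by move=> m; rewrite fS yE.
- by have := f_y_cvg; rewrite yy.
- by rewrite yy in hq.
- by rewrite yy in he.
- exact: mulf_neq0.
- by move=> z; apply: dvdz_gcd_mul_trans (hpq z); exact: dvdz_gcdl.
Qed.

Lemma oddX3 (j : nat) : odd (3 ^ j).
Proof. by rewrite oddX orbT. Qed.

(* (z - s) P(z) = z^3 - s^3, so q g - p is (w - s^3) g(w) - 1 with w = z^3. *)
Lemma approximants_a (s : int) : u = s -> v = s ^+ 2 -> s ^+ 3 != s ->
  exists p q, approximants (scale R b) (f 0%N) 1 2 p q.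
Proof.
move=> us vs s3; have lamS := shift_cvg lam_cvg; have xS := shift_cvg x_cvg.
(* Modulo P, z^3 is s^3, so [q] at z^(3^j) becomes the constant [s ^+ (3 ^ j) - s]. The limit is the
   w^-1 coefficient [c (u - s^3)] of (w - s^3) g(w), where [u = s]. *)
apply: (@approximants_of 1 2 (fun=> 1) (fun z => z - s) (fun j => s ^+ (3 ^ j) - s) 1
  (c%:~R * (s%:~R - s%:~R ^+ 3))) => //.
- have -> : (fun m => (y m - s)%:~R / (y m)%:~R ^+ 1) = fun m => 1 - s%:~R * x m.
    by apply/funext => m; rewrite rmorphB /x /=; field; rewrite yR_neq0.
  by apply: cvg_eq; [cvg_poly|ring].
- have -> : (fun m => ((y m - s)%:~R * f m - (c * 1)%:~R) * (y m)%:~R ^+ 3) =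
     fun m => c%:~R * s%:~R - c%:~R * (s%:~R * s%:~R * s%:~R)
       + x m.+1 * (lam m.+1 - c%:~R * (s%:~R * s%:~R * s%:~R * s%:~R))
       - s%:~R * s%:~R * s%:~R * lam m.+1 * (x m.+1 * x m.+1).
    apply/funext => m; rewrite rmorphB mulr1 /= fS_real fE_lam us vs /x yRS rmorphXn /=.
    by field; rewrite yR_neq0.
  by apply: cvg_eq; [cvg_poly|ring].
- rewrite mulf_neq0 ?intr_eq0// -rmorphXn -rmorphB intr_eq0 subr_eq0 eq_sym.
  exact: s3.
- move=> j j0; rewrite subr_eq0; apply: contra_neq s3 => sj.
  have [s2|s2] := leP 2 `|s|; last first.
    have : s = 0 \/ s = 1 \/ s = -1 by lia.
    by move=> [->|[->|->]].
  have : `|s| < `|s| ^+ (3 ^ j).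
    by rewrite ltr_eXnr ?(leq_ltn_trans _ (ltn_expl j _))//; lia.
  by rewrite -normrX sj ltxx.
- by move=> z; rewrite gcd1z.
- move=> j z j0.
  have -> : s ^+ (3 ^ j) - s = (z ^+ (3 ^ j) - s) - (z ^+ (3 ^ j) - s ^+ (3 ^ j)) by ring.
  apply: rpredB; first exact: dvdz_gcdr.
  apply: dvdz_trans (dvdz_gcdl _ _) _; rewrite us vs.
  apply: (@dvdz_trans (z ^+ 3 - s ^+ 3)).
    by apply/dvdzP; exists (z - s); ring.
  by rewrite -(prednK j0) expnS !exprM dvdz_subXX.
Qed.

(** As [s ^+ 3 = s], the identity (z - s) P(z) = z^3 - s makes (z - s) g(z) invariant under cubing
    z. Along [y m] it is constant and tends to [c], so g(b) = c / (b - s). *)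
Lemma rational_a (s : int) : u = s -> v = s ^+ 2 -> s ^+ 3 = s ->
  ~ irrational (f 0%N).
Proof.
move=> us vs s3 irr.
have s1 : `|s| < 2.
  rewrite ltNge; apply/negP => s2; have : `|s| < `|s| ^+ 3.
    by rewrite ltr_eXnr; lia.
  by rewrite -normrX s3 ltxx.
have const m : ((y m)%:~R - s%:~R) * f m = ((y 0%N)%:~R - s%:~R) * f 0%N.
  elim: m => [//|m <-]; rewrite yRS (fS_real m) us vs rmorphXn /=.
  rewrite mulrA; congr (_ * _).
  by rewrite -[in LHS]s3 rmorphXn /=; ring.
have lim : (fun m => ((y m)%:~R - s%:~R) * f m) @ \oo --> (c%:~R : R).
  have -> : (fun m => ((y m)%:~R - s%:~R) * f m) =
      fun m => f m * (y m)%:~R - s%:~R * f m by apply/funext => m; ring.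
  have fy := f_y_cvg; have f0 := f_cvg0.
  by apply: cvg_eq; [cvg_poly|ring].
rewrite (_ : (fun m => _) = fun=> ((y 0%N)%:~R - s%:~R) * f 0%N) in lim; last exact/funext.
have cE : ((y 0%N)%:~R - s%:~R) * f 0%N = c%:~R.
  by apply: (cvg_unique _ _ lim) => //; exact: cvg_cst.
have ys : y 0%N - s != 0 by rewrite yE expr1; lia.
have ysR : (y 0%N)%:~R - s%:~R != 0 :> R by rewrite -rmorphB intr_eq0.
apply: irr; exists (c%:~R / (y 0%N - s)%:~R) => //.
by rewrite ratr_divz rmorphB /= -cE mulrAC divff// mul1r.
Qed.

(** P = (z - s)(z - r) with r = -(s^3 + s), and [q] completes z - s to z^3 - s^3. In (w - s^3) g(w)
    - c the w^-1 term vanishes because [u = s ^+ 3], which makes the order jump; the w^-2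
    coefficient [c (v - u^2)] is the limit. *)
Lemma approximants_b (s : int) : u = s ^+ 3 -> v = - (s ^+ 2 * (s ^+ 2 + 1)) -> s != 0 ->
  exists p q, approximants (scale R b) (f 0%N) 2 4 p q.
Proof.
move=> us vs s0; have lamS := shift_cvg lam_cvg; have xS := shift_cvg x_cvg.
have qpos z : 0 < z ^+ 2 + s * z + s ^+ 2.
  have s2 : 0 < s ^+ 2 by rewrite exprn_even_gt0.
  have sq : 0 <= (2 * z + s) ^+ 2 by rewrite sqr_ge0.
  suff : 0 < 4 * (z ^+ 2 + s * z + s ^+ 2) by lia.
  have -> : 4 * (z ^+ 2 + s * z + s ^+ 2) = (2 * z + s) ^+ 2 + 3 * s ^+ 2 by ring.
  by lia.
have qsub z w : (z - w %| (z ^+ 2 + s * z + s ^+ 2) - (w ^+ 2 + s * w + s ^+ 2))%Z.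
  by apply/dvdzP; exists (z + w + s); ring.
pose q z := z ^+ 2 + s * z + s ^+ 2; pose r := - (s ^+ 3 + s).
(* The roots of P are [s] and [r], so common factors are bounded by the values of [q] at their
   powers, which positivity of [q] keeps nonzero. *)
apply: (@approximants_of 2 4 (fun z => z + s ^+ 3 + s) q
  (fun j => q (s ^+ (3 ^ j)) * q (r ^+ (3 ^ j))) (q r)
  (- (c%:~R * (s%:~R ^+ 2 * (1 + s%:~R ^+ 2 + s%:~R ^+ 4))))) => //.
- have -> : (fun m => (q (y m))%:~R / (y m)%:~R ^+ 2) =
     fun m => 1 + s%:~R * x m + s%:~R * s%:~R * (x m * x m).
    apply/funext => m; rewrite /q /x.
    by field; rewrite yR_neq0.
  by apply: cvg_eq; [cvg_poly|ring].
- (* P q = (w - s^3) p with w = z^3, hence q g - p = p ((w - s^3) g(w) - 1). *)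
  have -> : (fun m => ((q (y m))%:~R * f m - (c * (y m + s ^+ 3 + s))%:~R) * (y m)%:~R ^+ 5) =
     fun m => (1 + (u%:~R + s%:~R) * x m) *
       (lam m.+1 - c%:~R * u%:~R * u%:~R - u%:~R * lam m.+1 * x m.+1).
    apply/funext => m; rewrite /q fS_real fE_lam us vs /x yRS.
    by field; rewrite yR_neq0.
  by apply: cvg_eq; [cvg_poly|rewrite us vs; ring].
- rewrite oppr_eq0 mulf_neq0 ?intr_eq0// mulf_neq0 ?expf_neq0 ?intr_eq0//.
  rewrite gt_eqF// ltr_wpDr ?exprn_even_ge0// ltr_wpDr ?exprn_even_ge0//.
- by rewrite gt_eqF// /q.
- by move=> j j0; rewrite mulf_neq0// gt_eqF// /q.
- move=> z; have -> : z + s ^+ 3 + s = z - r by rewrite /r; ring.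
  by have := dvdz_gcd_root r z 1 qsub; rewrite !expr1.
- move=> j z j0.
  have -> : z ^+ 2 + u * z + v = (z - s) * (z - r) by rewrite us vs /r; ring.
  by apply: dvdz_gcd_mul_trans; exact: (@dvdz_gcd_root q).
Qed.

Section Square.
(* u = 2 sg and v = 1, that is P = (z + sg)^2. *)
Variable sg : int.
Hypotheses (sg1 : sg = 1 \/ sg = -1) (usg : u = 2 * sg) (v1 : v = 1).

(** The double root [- sg] of P is fixed by odd powers, so one bound serves all [j]. *)
Lemma dvdz_gcd_square (q : int -> int) (j : nat) (z : int) :
  (forall x y, (x - y %| q x - q y)%Z) ->
  (gcdz (z ^+ 2 + u * z + v) (q (z ^+ (3 ^ j))) %| q (- sg) * q (- sg))%Z.
Proof.
move=> hq; have -> : z ^+ 2 + u * z + v = (z - - sg) * (z - - sg).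
  by rewrite usg v1; case: sg1 => ->; ring.
have sgX : (- sg) ^+ (3 ^ j) = - sg.
  by case: sg1 => ->; rewrite ?opprK ?expr1n// -signr_odd oddX3 expr1.
have := dvdz_gcd_root (- sg) z (3 ^ j) hq; rewrite sgX => h.
exact: dvdz_gcd_mul_trans.
Qed.

(** The choice [q = z - u] cancels the z^-1 term of q g - c, and the z^-2 coefficient is
    [c (v - u^2) = -3 c]. *)
Lemma approximants_c1 : exists p q, approximants (scale R b) (f 0%N) 1 1 p q.
Proof.
pose q z := z - 2 * sg.
apply: (@approximants_of 1 1 (fun=> 1) q (fun=> q (- sg) * q (- sg)) 1 (- (3 * c%:~R))) => //.
- have -> : (fun m => (q (y m))%:~R / (y m)%:~R ^+ 1) = fun m => 1 - 2 * sg%:~R * x m.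
    by apply/funext => m; rewrite /q /x; field; rewrite yR_neq0.
  by apply: cvg_eq; [cvg_poly|ring].
- have -> : (fun m => ((q (y m))%:~R * f m - (c * 1)%:~R) * (y m)%:~R ^+ 2) =
     fun m => lam m - 4 * c%:~R - 2 * sg%:~R * lam m * x m.
    apply/funext => m; rewrite /q fE_lam usg /x.
    by case: sg1 => ->; field; rewrite yR_neq0.
  by apply: cvg_eq; [cvg_poly|rewrite v1; ring].
- by rewrite oppr_eq0 mulf_neq0 ?intr_eq0.
- by move=> j _; rewrite /q; case: sg1 => ->.
- by move=> z; rewrite gcd1z.
- by move=> j z _; apply: dvdz_gcd_square => z1 z2; apply/dvdzP; exists 1; rewrite /q; ring.
Qed.

Lemma approximants_c4 : exists p q, approximants (scale R b) (f 0%N) 4 4 p q.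
Proof.
have lamS := shift_cvg (shift_cvg lam_cvg).
have xS := shift_cvg x_cvg; have xSS := shift_cvg xS.
pose q z := z ^+ 4 - 2 * sg * z ^+ 3 + z ^+ 2 - 2 * sg * z + 3.
apply: (@approximants_of 4 4 (fun z => z * (z ^+ 2 - 2)) q (fun=> q (- sg) * q (- sg))
  (3 * 9) (6 * c%:~R)) => //.
- have -> : (fun m => (q (y m))%:~R / (y m)%:~R ^+ 4) = fun m => 1 - 2 * sg%:~R * x m
      + x m * x m - 2 * sg%:~R * (x m * x m * x m) + 3 * (x m * x m * x m * x m).
    apply/funext => m; rewrite /q /x.
    by field; rewrite yR_neq0.
  by apply: cvg_eq; [cvg_poly|ring].
(* After two uses of the functional equation, [f m.+2 = x (c + x k)] with [x = x m.+2]: [k m] is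
   what remains past the leading term. *)
- pose k m := 2 * sg%:~R * c%:~R + x m.+2 * lam m.+2.
  have k_cvg : k @ \oo --> (2 * sg%:~R * c%:~R : R).
    by apply: cvg_eq; [cvg_poly|ring].
  have -> : (fun m =>
      ((q (y m))%:~R * f m - (c * (y m * (y m ^+ 2 - 2)))%:~R) * (y m)%:~R ^+ 5) =
     fun m => 2 * (c%:~R * (3 + 2 * sg%:~R * x m.+1)
         - (1 - 3 * (x m.+1 * x m.+1)
            - 2 * sg%:~R * (x m.+1 * x m.+1 * x m.+1)) * x m.+1 * k m)
       + x m * (c%:~R * (4 * sg%:~R + 3 * x m.+1)
         + (1 + 4 * sg%:~R * (x m.+1 * x m.+1 * x m.+1)
            + 3 * (x m.+1 * x m.+1 * x m.+1 * x m.+1)) * k m).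
    apply/funext => m; rewrite /q fS_real (fS_real m.+1) fE_lam /k usg v1 /x !yRS.
    by case: sg1 => ->; field; rewrite yR_neq0.
  by apply: cvg_eq; [cvg_poly|ring].
- by rewrite mulf_neq0 ?intr_eq0.
- by move=> j _; rewrite /q; case: sg1 => ->.
(* Modulo [z], [q] is 3; modulo [z^2 - 2] it is [9 - 6 sg z], whose product with [9 + 6 sg z] is
   9. *)
- move=> z; apply: dvdz_gcd_mul_trans.
    apply: (@dvdz_gcd_lin (- (z ^+ 3 - 2 * sg * z ^+ 2 + z - 2 * sg)) 1).
    by rewrite /q; ring.
  apply: (@dvdz_gcd_lin (36 - (9 + 6 * sg * z) * (z ^+ 2 - 2 * sg * z + 3)) (9 + 6 * sg * z)).
  by rewrite /q; case: sg1 => ->; ring.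
- move=> j z _; apply: dvdz_gcd_square => z1 z2; apply/dvdzP.
  exists (z1 ^+ 3 + z1 ^+ 2 * z2 + z1 * z2 ^+ 2 + z2 ^+ 3
    - 2 * sg * (z1 ^+ 2 + z1 * z2 + z2 ^+ 2) + z1 + z2 - 2 * sg).
  by rewrite /q; ring.
Qed.

(** The source is (w + 2 sg) / (w^2 - 1) as an approximant of g(w), w = z^3, multiplied by P(z) and
    reduced by z + sg. In (w^2 - 1) g(w) the w^-1 coefficient vanishes since [v = 1], and the w^-2
    one since g has equal coefficients at w^-4 and w^-2; the w^-3 one is [c (u^2 - 1) = 3 c]. *)
Lemma approximants_c5 : exists p q, approximants (scale R b) (f 0%N) 5 7 p q.
Proof.
have lamS := shift_cvg (shift_cvg lam_cvg).
have xS := shift_cvg x_cvg; have xSS := shift_cvg xS.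
pose q z := z ^+ 5 - sg * z ^+ 4 + z ^+ 3 - sg * z ^+ 2 + z - sg.
apply: (@approximants_of 5 7 (fun z => (z + sg) * (z ^+ 3 + 2 * sg)) q
  (fun=> q (- sg) * q (- sg)) (6 * 3) (3 * c%:~R)) => //.
- have -> : (fun m => (q (y m))%:~R / (y m)%:~R ^+ 5) = fun m => 1 - sg%:~R * x m
      + x m * x m - sg%:~R * (x m * x m * x m) + x m * x m * x m * x m
      - sg%:~R * (x m * x m * x m * x m * x m).
    apply/funext => m; rewrite /q /x.
    by field; rewrite yR_neq0.
  by apply: cvg_eq; [cvg_poly|ring].
- pose k m := 2 * sg%:~R * c%:~R + x m.+2 * lam m.+2.
  have k_cvg : k @ \oo --> (2 * sg%:~R * c%:~R : R).
    by apply: cvg_eq; [cvg_poly|ring].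
  (* q P = (z + sg) (w^2 - 1) with w = z^3, so that w = y m.+1 takes over. *)
  have -> : (fun m => ((q (y m))%:~R * f m
      - (c * ((y m + sg) * (y m ^+ 3 + 2 * sg)))%:~R) * (y m)%:~R ^+ 8) =
     fun m => (1 + sg%:~R * x m) * (3 * c%:~R
       + (1 + 2 * sg%:~R * x m.+1) * (x m.+1 * x m.+1) * lam m.+2
       - (2 * sg%:~R + x m.+1) * (x m.+1 * x m.+1) * k m).
    apply/funext => m; rewrite /q fS_real (fS_real m.+1) fE_lam /k usg v1 /x !yRS.
    by case: sg1 => ->; field; rewrite yR_neq0.
  by apply: cvg_eq; [cvg_poly|ring].
- by rewrite mulf_neq0 ?intr_eq0.
- by move=> j _; rewrite /q; case: sg1 => ->.
(* At [z = - sg] the value of [q] is [- 6 sg], and [(z + sg) q = z^6 - 1] is 3 modulo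
   [z^3 + 2 sg]. *)
- move=> z; apply: dvdz_gcd_mul_trans.
    apply: (@dvdz_gcd_lin
      (sg * (z ^+ 4 - 2 * sg * z ^+ 3 + 3 * z ^+ 2 - 4 * sg * z + 5)) (- sg)).
    by rewrite /q; case: sg1 => ->; ring.
  apply: (@dvdz_gcd_lin (- (z ^+ 3 - 2 * sg)) (z + sg)).
  by rewrite /q; case: sg1 => ->; ring.
- move=> j z _; apply: dvdz_gcd_square => z1 z2.
  rewrite (_ : q z1 - q z2 = (z1 ^+ 5 - z2 ^+ 5) - sg * (z1 ^+ 4 - z2 ^+ 4)
    + (z1 ^+ 3 - z2 ^+ 3) - sg * (z1 ^+ 2 - z2 ^+ 2) + (z1 - z2)); last by rewrite /q; ring.
  apply: rpredD; last exact: dvdzz.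
  apply: rpredB; last by apply: dvdz_mull; exact: dvdz_subXX.
  apply: rpredD; last exact: dvdz_subXX.
  by apply: rpredB; [|apply: dvdz_mull]; exact: dvdz_subXX.
Qed.

End Square.
End Cases.

(** * Nonvanishing from irrationality, and the three cases *)

Lemma irrational_neq0 (R : realType) (xi : R) : irrational xi -> xi != 0.
Proof. by move=> irr; apply/eqP => xi0; apply: irr; exists 0; rewrite ?rmorph0. Qed.

(** Without its leading coefficient the whole series vanishes, and the value would be the rational
    0. *)
Lemma tail_coef0_neq0 (R : realType) (g : laurent int) (u v : int) (x : R) :
  g = lmulp ('X^2 + u%:P * 'X + v%:P) (lsubstX 3 g) -> 2 <= `|x| ->
  irrational (leval g x) -> tail_coef g 0 != 0.
Proof.
move=> gE x2 /irrational_neq0; apply: contra_neq => c0.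
rewrite (leval_tail gE x2) (_ : series _ = fun=> 0) ?lim_cst ?mulr0//.
apply/funext => n; rewrite seriesEnat /= big1// => i _.
by rewrite /tail_term (tail_coef_eq0 gE c0) mul0r.
Qed.

Theorem theorem3 (R : realType) (g : int -> int -> laurent int)
    (hg : forall a1 a2 : int,
        g a1 a2 = lmulp ('X^2 + a1%:P * 'X + a2%:P) (lsubstX 3 (g a1 a2)))
    (b : int) (hb : 2 <= `|b|) :
  [/\ (forall s : int,
         irrational (leval (g s (s ^+ 2)) b%:~R : R) ->
         irrationality_exponent (leval (g s (s ^+ 2)) b%:~R : R) = 3%:E),
      (forall s : int,
         irrational (leval (g (s ^+ 3) (- (s ^+ 2 * (s ^+ 2 + 1)))) b%:~R : R) ->
         irrationality_exponent
           (leval (g (s ^+ 3) (- (s ^+ 2 * (s ^+ 2 + 1)))) b%:~R : R) = 3%:E)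
    & (forall a : int, a = 2 \/ a = - 2 ->
         irrational (leval (g a 1) b%:~R : R) ->
         irrationality_exponent (leval (g a 1) b%:~R : R) = (12%:R / 5%:R)%:E)].
Proof.
have T1 m : 1 <= scale R b m := scale_ge1 R m hb.
have Too := @scale_cvg R b hb; have TS := scaleS R b.
pose y m : int := b ^+ (3 ^ m).
pose f a1 a2 m : R := leval (g a1 a2) (y m)%:~R.
have fE a1 a2 : leval (g a1 a2) b%:~R = f a1 a2 0%N.
  by rewrite /f /y expn0 expr1.
have yE m : y m = b ^+ (3 ^ m) by [].
have b2R : 2 <= `|b%:~R : R| by rewrite -intr_norm -[2]/(2%:~R) ler_int.
have three : 1 + 2%:R / 1%:R = 3 :> R by field.
split=> [s|s|a a2].
- have [fS xc lc] := leval_expansion R (hg s (s ^+ 2)) hb.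
  rewrite fE => irr; have f0 := irrational_neq0 irr.
  have c0 := tail_coef0_neq0 (hg s (s ^+ 2)) b2R; rewrite fE in c0.
  (* For [s] in {0, 1, -1} the value is rational, which contradicts [irr]. *)
  have [s3|s3] := eqVneq (s ^+ 3) s.
    by have := rational_a hb f0 (c0 irr) yE fS xc lc erefl erefl s3 irr.
  have [p [q pq]] := approximants_a hb f0 (c0 irr) yE fS xc lc erefl erefl s3.
  by rewrite (irrationality_exponent_single T1 Too TS _ _ irr pq)// three.
- set u := s ^+ 3; set v := - _.
  have [fS xc lc] := leval_expansion R (hg u v) hb.
  rewrite fE => irr; have f0 := irrational_neq0 irr.
  have c0 := tail_coef0_neq0 (hg u v) b2R; rewrite fE in c0.
  (* For [s = 0] the polynomial is z^2, already treated by [rational_a]. *)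
  have [s0|s0] := eqVneq s 0.
    have u0 : u = 0 by rewrite /u s0.
    have v0 : v = 0 ^+ 2 by rewrite /v s0.
    by have := rational_a hb f0 (c0 irr) yE fS xc lc u0 v0 erefl irr.
  have [p [q pq]] := approximants_b hb f0 (c0 irr) yE fS xc lc erefl erefl s0.
  rewrite (irrationality_exponent_single T1 Too TS _ _ irr pq)//.
  by congr (_%:E); field.
- have [sg sg1 asg] : exists2 sg : int, sg = 1 \/ sg = -1 & a = 2 * sg.
    by case: a2 => ->; [exists 1; [left|]|exists (-1); [right|]].
  have [fS xc lc] := leval_expansion R (hg a 1) hb.
  rewrite fE => irr; have f0 := irrational_neq0 irr.
  have c0 := tail_coef0_neq0 (hg a 1) b2R; rewrite fE in c0.
  have [p1 [q1 h1]] := approximants_c1 hb f0 (c0 irr) yE fS xc lc sg1 asg erefl.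
  have [p4 [q4 h4]] := approximants_c4 hb f0 (c0 irr) yE fS xc lc sg1 asg erefl.
  have [p5 [q5 h5]] := approximants_c5 hb f0 (c0 irr) yE fS xc lc sg1 asg erefl.
  exact: irrationality_exponent_triple T1 Too TS irr h1 h4 h5.
Qed.
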